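(* Let $D$ be a skew diagram of size $n$. Then the skew Schur function $s_D$ is F-multiplicity free if and only if, up to transpose, $D$ or $D^\circ$ is one of the following: (i) $(3,3)$ if $n=6$; (ii) $(4,4)$ if $n=8$; (iii) $(n-2,2)$ if $n\geq 4$; (iv) $(n-k,1^k)$ if $n\geq 1$ and $0\le k\le n-1$; (v) $(n-k)\oplus(1^k)$ with $0<k<n$. Consequently this is a complete list of skew diagrams $D$ such that all standard Young tableaux of shape $D$ have distinct descent sets.
   Context: For partitions $\mu\subseteq\lambda$ (i.e. $\ell(\mu)\le\ell(\lambda)$ and $\mu_i\le\lambda_i$), the skew diagram $\lambda/\mu$ is the set of cells $(i,j)$ (row $i$ from the top, column $j$) lying in the Young diagram of $\lambda$ but not of $\mu$; a partition $\lambda$ is viewed as the skew diagram $\lambda/\emptyset$. The size $|D|$ is the number of cells. $D^\circ$ is the rotation of $D$ by $180^\circ$; the transpose $D^t=\{(i,j):(j,i)\in D\}$. For skew diagrams $D_1,D_2$, $D_1\oplus D_2$ is obtained by placing $D_2$ strictly north and east of $D_1$ so that they share no rows and no columns; thus $(n-k)\oplus(1^k)$ is a row of $n-k$ cells together with a column of $k$ cells placed strictly to its north-east. A standard Young tableau (SYT) of shape $D$ with $|D|=n$ is a filling of the cells with $1,\dots,n$, each once, increasing left to right along rows and top to bottom along columns; its descent set is the set of $i$ such that $i+1$ lies in a strictly lower row than $i$, and $\mathrm{com}(T)$ is the composition $\alpha$ of $n$ with $\mathrm{set}(\alpha)$ equal to this descent set, where $\mathrm{set}(\alpha_1,\dots,\alpha_k)=\{\alpha_1,\alpha_1+\alpha_2,\dots,\alpha_1+\cdots+\alpha_{k-1}\}$.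 The fundamental quasisymmetric function is $F_\alpha=\sum x_{i_1}\cdots x_{i_n}$ over $i_1\le\cdots\le i_n$ with $i_j<i_{j+1}$ whenever $j\in\mathrm{set}(\alpha)$. The skew Schur function is $s_D=\sum_T F_{\mathrm{com}(T)}$ over all SYT $T$ of shape $D$. A quasisymmetric function $\sum_\alpha c_\alpha F_\alpha$ is F-multiplicity free if every $c_\alpha\in\{0,1\}$. *)

(* Defs.v *)
(* Cells and variables are indexed from 0; tableau entries run over 1..n. *)
From HB Require Import structures.
From mathcomp Require Import all_boot all_order all_algebra.
From mathcomp Require Import finmap multiset.

Set Implicit Arguments.
Unset Strict Implicit.
Unset Printing Implicit Defensive.

Import Order.TTheory GRing.Theory Num.Theory.
Local Open Scope fset_scope.

(* A cell is (row, column), rows increasing downwards.  Integer coordinates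
   let rotation and translation be plain coordinate changes. *)
Definition cell := (int * int)%type.
Definition diagram := {fset cell}.

Definition is_part (la : seq nat) : bool := sorted geq la && (0 \notin la).

Definition part_sub (mu la : seq nat) : Prop :=
  size mu <= size la /\ forall i, nth 0 mu i <= nth 0 la i.

Definition young (la : seq nat) : diagram :=
  [fset c in [seq ((i%:Z)%R, (j%:Z)%R) | i <- iota 0 (size la),
                                         j <- iota 0 (nth 0 la i)]].

Definition skew (la mu : seq nat) : diagram := young la `\` young mu.

Definition is_skew_diagram (D : diagram) : Prop :=
  exists la mu, [/\ is_part la, is_part mu, part_sub mu la & D = skew la mu].

Definition transpose (D : diagram) : diagram := [fset (c.2, c.1) | c in D].

Definition rotate (D : diagram) : diagram :=
  [fset ((- c.1)%R, (- c.2)%R) | c in D].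

Definition translate (v : int * int) (D : diagram) : diagram :=
  [fset ((c.1 + v.1)%R, (c.2 + v.2)%R) | c in D].

Definition same_shape (D E : diagram) : Prop := exists v, D = translate v E.

(* D is a copy of D1 together with a copy of D2 placed strictly to its north
   and east; only the relative position is constrained, so empty rows or columns
   between the two copies are allowed (as happens in (4,1)/(3)). *)
Definition is_dsum (D1 D2 D : diagram) : Prop :=
  exists v1 v2,
    D = translate v1 D1 `|` translate v2 D2 /\
    forall c1 c2, c1 \in translate v1 D1 -> c2 \in translate v2 D2 ->
      (c2.1 < c1.1)%R /\ (c1.2 < c2.2)%R.

Definition filling (D : diagram) := {ffun D -> 'I_#|`D|}.

Definition entry (D : diagram) (T : filling D) (c : D) : nat := (T c).+1.

Definition is_syt (D : diagram) (T : filling D) : bool :=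
  [&& injectiveb T,
      [forall c : D, forall d : D,
         ((val c).1 == (val d).1) && ((val c).2 < (val d).2)%R
           ==> (entry T c < entry T d)] &
      [forall c : D, forall d : D,
         ((val c).2 == (val d).2) && ((val c).1 < (val d).1)%R
           ==> (entry T c < entry T d)]].

Definition is_descent (D : diagram) (T : filling D) (i : nat) : bool :=
  [exists c : D, exists d : D,
     [&& entry T c == i, entry T d == i.+1 & ((val c).1 < (val d).1)%R]].

(* The descent set, listed increasingly (hence canonically). *)
Definition descents (D : diagram) (T : filling D) : seq nat :=
  [seq i <- iota 1 #|`D|.-1 | is_descent T i].

Definition is_comp (al : seq nat) : bool := 0 \notin al.

Definition comp_set (al : seq nat) : seq nat :=
  [seq sumn (take i al) | i <- iota 1 (size al).-1].

(* The composition of n whose comp_set is the increasing list s of elements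
   of 1..n-1. *)
Definition comp_of_set (n : nat) (s : seq nat) : seq nat :=
  if n is 0 then [::] else pairmap (fun a b => b - a) 0 (rcons s n).

Definition com (D : diagram) (T : filling D) : seq nat :=
  comp_of_set #|`D| (descents T).

(* Formal power series over int in x_0, x_1, ...: a monomial is the multiset
   of the indices of its variables, a series maps it to its coefficient. *)
Definition series := {mset nat}%mset -> int.

Definition F_index (al s : seq nat) : bool :=
  [&& size s == sumn al, sorted leq s &
      all (fun j => nth 0 s j.-1 < nth 0 s j) (comp_set al)].

(* The sequences (i_1, ..., i_n) with x_{i_1} ... x_{i_n} equal to the monomial
   m are the permutations of m; i_j is nth 0 s j.-1 in F_index. *)
Definition F (al : seq nat) : series :=
  fun m => Posz (count (F_index al) (permutations (enum_mset m))).

Definition skew_schur (D : diagram) : series :=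
  fun m => (\sum_(T : filling D | is_syt T) F (com T) m)%R.

Definition F_expansion (f : series) (c : {fsfun seq nat -> int with 0%R}) : Prop :=
  (forall al, al \in finsupp c -> is_comp al) /\
  forall m, f m = (\sum_(al <- finsupp c) c al * F al m)%R.

Definition F_multiplicity_free (f : series) : Prop :=
  exists2 c, F_expansion f c & forall al, c al = 0%R \/ c al = 1%R.

Definition distinct_descent_sets (D : diagram) : Prop :=
  forall T U : filling D, is_syt T -> is_syt U ->
    descents T = descents U -> T = U.

Definition in_list (n : nat) (D : diagram) : Prop :=
  (n = 6 /\ same_shape D (young [:: 3; 3])) \/
  (n = 8 /\ same_shape D (young [:: 4; 4])) \/
  (4 <= n /\ same_shape D (young [:: n - 2; 2])) \/
  (1 <= n /\ exists k, k <= n - 1 /\ same_shape D (young (n - k :: nseq k 1))) \/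
  (exists k, 0 < k < n /\ is_dsum (young [:: n - k]) (young (nseq k 1)) D).

Definition in_list_up_to_transpose (n : nat) (D : diagram) : Prop :=
  in_list n D \/ in_list n (transpose D).

(* Main.v *)
Require Import Defs.
From mathcomp Require Import all_boot all_order all_algebra.
From mathcomp Require Import finmap multiset zify.

(* Record a standard tableau as the list of its cells in the order of their entries:
   it is a linear extension of the componentwise order on the cells, the descents
   are read off consecutive rows, transposition complements the descent word and
   rotation reverses it. If a convex part of D has two linear extensions with the
   same descents, they extend to D as soon as the junctions with the remaining
   cells agree. A pigeonhole argument on the junction then shows that a diagram with
   distinct descent sets has at most two maximal cells and, by rotation, at most two
   minimal ones. So D is a union of at most four rectangles, and a few patterns,
   namely a 2x2 block with a cell strictly north-east or south-west of it, two rows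
   of length 3 overlapping in one column, (4,3), two separate rows and a Z-shape,
   exclude everything outside the list. On the listed shapes the descent word
   determines the tableau. Finally F-multiplicity freeness amounts to distinct
   descent sets by the linear independence of the F_alpha, which follows by
   evaluating at the monomial of a shortest composition in the support. *)

Set Implicit Arguments.
Unset Strict Implicit.
Unset Printing Implicit Defensive.

Import Order.TTheory GRing.Theory Num.Theory.
Local Open Scope fset_scope.
Local Open Scope nat_scope.

(** * Linear extensions and their descent words *)

Definition cle (c d : cell) : bool := ((c.1 <= d.1) && (c.2 <= d.2))%R.

(** Order convexity is the only property of skew diagrams on which the argument rests. In contrast
    to a pair of partitions, it is visibly preserved by rotation and transposition. *)
Definition convex (D : diagram) : Prop :=
  forall x y z, x \in D -> y \in D -> cle x z -> cle z y -> z \in D.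

(** As [cle] is reflexive, this also forbids repeated cells. *)
Definition ordered (s : seq cell) : bool := pairwise (fun c d => ~~ cle d c) s.

Definition linext (D : diagram) (s : seq cell) : Prop := ordered s /\ s =i D.

Definition dbit (c d : cell) : bool := (c.1 < d.1)%R.

Definition dword (s : seq cell) : seq bool :=
  if s is x :: s' then pairmap dbit x s' else [::].

(** The form of [distinct_descent_sets] for linear extensions; the two agree on convex diagrams. *)
Definition ddf (D : diagram) : Prop :=
  forall s t, linext D s -> linext D t -> dword s = dword t -> s = t.

Lemma cle_refl x : cle x x.
Proof. by rewrite /cle !lexx. Qed.

Lemma cle_trans y x z : cle x y -> cle y z -> cle x z.
Proof. by rewrite /cle; lia. Qed.

Lemma cle_anti x y : cle x y -> cle y x -> x = y.
Proof. by case: x y => [a b] [c d]; rewrite /cle /= => *; congr pair; lia. Qed.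

Lemma ordered_uniq s : ordered s -> uniq s.
Proof.
rewrite uniq_pairwise; apply: sub_pairwise => x y /=.
by apply: contraNneq => ->; rewrite cle_refl.
Qed.

Lemma dword_cat x s y t :
  dword ((x :: s) ++ y :: t) = dword (x :: s) ++ dbit (last x s) y :: dword (y :: t).
Proof. by rewrite /= pairmap_cat. Qed.

(** Sorting by row, then by column, refines [cle]. The last two clauses control the rows of the end
    cells, on which the junction bits of a concatenation depend. *)
Lemma row_major (A : seq cell) : uniq A -> exists s : seq cell,
  [/\ ordered s, s =i A, forall x s', s = x :: s' -> {in A, forall y, (x.1 <= y.1)%R}
    & forall x s', s = x :: s' -> {in A, forall y, (y.1 <= (last x s').1)%R}].
Proof.
pose r (c d : cell) := ((c.1 < d.1) || (c.1 == d.1) && (c.2 <= d.2))%R.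
have r_total : total r by move=> x y; rewrite /r; lia.
have r_trans : transitive r by move=> y x z; rewrite /r; lia.
move=> uA; exists (sort r A); have sE := mem_sort r A.
have so : sorted r (sort r A) by exact: sort_sorted.
split=> //.
- move: (so); rewrite sorted_pairwise // => pr.
  have : uniq (sort r A) by rewrite sort_uniq.
  rewrite uniq_pairwise => pn; rewrite /ordered.
  apply: (@sub_pairwise _ [rel x y | r x y && (x != y)]).
    move=> [a b] [c d] /=; rewrite /r /cle /= => /andP[h1 h2].
    by apply: contra h2; rewrite xpair_eqE; lia.
  by rewrite pairwise_relI pr.
- move=> x s' e y; rewrite -sE e inE => /predU1P[-> //|yin].
  by move: so; rewrite e sorted_pairwise //= => /andP[/allP/(_ _ yin) + _]; rewrite /r; lia.
- move=> x s' e y; rewrite -sE.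
  move: so; rewrite e; case/lastP: s' {e} => [|s' z]; first by rewrite inE => _ /eqP ->.
  rewrite last_rcons sorted_pairwise // -rcons_cons pairwise_rcons => /andP[/allP h _].
  by rewrite mem_rcons inE => /predU1P[-> //|/h]; rewrite /= /r; lia.
Qed.

(* The cells of D outside the middle part are placed before it (when P holds) or
   after it; reading them row by row makes the two junctions depend only on the
   lowest row of the first group and on the top row of the second one. *)
Lemma swap_middle (D : diagram) (P : pred cell) (s t : seq cell) (c0 : cell) :
  ordered s -> ordered t -> s =i t -> {subset s <= D} ->
  dword s = dword t -> s <> t ->
  (forall y c, y \in D -> y \notin s -> P y -> c \in s -> ~~ cle c y) ->
  (forall c z, z \in D -> z \notin s -> ~~ P z -> c \in s -> ~~ cle z c) ->
  (forall y z, y \in D -> z \in D -> P y -> ~~ P z -> ~~ cle z y) ->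
  (forall y, y \in D -> y \notin s -> P y ->
    (forall y', y' \in D -> y' \notin s -> P y' -> (y'.1 <= y.1)%R) ->
    dbit y (head c0 s) = dbit y (head c0 t)) ->
  (forall z, z \in D -> z \notin s -> ~~ P z ->
    (forall z', z' \in D -> z' \notin s -> ~~ P z' -> (z.1 <= z'.1)%R) ->
    dbit (last c0 s) z = dbit (last c0 t) z) ->
  ~ ddf D.
Proof.
move=> os ot st sD dst neq hIs hsJ hIJ hI hJ ddfD.
have [i [oi iE _ ilast]] := row_major
  (filter_uniq (fun z => (z \notin s) && P z) (fset_uniq D)).
have [j [oj jE jhead _]] := row_major
  (filter_uniq (fun z => (z \notin s) && ~~ P z) (fset_uniq D)).
have key u : ordered u -> u =i s -> linext D (i ++ u ++ j).
  move=> ou uE; split.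
    move: oi ou oj; rewrite /ordered !pairwise_cat allrel_catr => -> -> ->.
    rewrite !andbT -andbA; apply/and3P; split; apply/allrelP => y z.
    - by rewrite iE mem_filter uE => /andP[/andP[yn Py] yD]; exact: hIs.
    - rewrite iE jE !mem_filter => /andP[/andP[_ Py] yD] /andP[/andP[_ Pz] zD].
      exact: hIJ.
    - by rewrite jE mem_filter uE => ys /andP[/andP[zn Pz] zD]; exact: hsJ.
  move=> z; rewrite !mem_cat iE jE uE !mem_filter.
  by case: (boolP (z \in s)) => [/sD ->|_]; case: (P z) => /=; rewrite ?orbT ?orbF.
have ls := key s os (fun=> erefl); have lt := key t ot (fun x => esym (st x)).
suff e : dword (i ++ s ++ j) = dword (i ++ t ++ j).
  move/eqP: (ddfD _ _ ls lt e).
  rewrite eqseq_cat // eqxx /= eqseq_cat; first by move/andP=> [/eqP].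
  by apply/eqP; rewrite -uniq_size_uniq ?ordered_uniq.
have [x [s' sE]] : exists x s', s = x :: s'.
  case: (s) st neq => [|x s' _ _]; last by exists x, s'.
  by case: (t) => // y t' /(_ y); rewrite !inE eqxx.
have [y [t' tE]] : exists y t', t = y :: t'.
  case: (t) st => [|y t' _]; last by exists y, t'.
  by move/(_ x); rewrite sE inE eqxx.
have dsj : dword (s ++ j) = dword (t ++ j).
  case: j jE jhead {oj key ls lt} => [|z j] jE jhead; first by rewrite !cats0.
  have := mem_head z j; rewrite jE mem_filter => /andP[/andP[zn zh] zD].
  have e : dbit (last c0 s) z = dbit (last c0 t) z.
    apply: hJ => // z' z'D z'n z'h; apply: (jhead _ _ erefl).
    by rewrite mem_filter z'n z'h.
  by move: e dst; rewrite sE tE !dword_cat /= => -> ->.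
case: i iE ilast {oi key ls lt} => [|b i] iE ilast //.
have h u c u' : u = c :: u' ->
    dword ((b :: i) ++ u ++ j) = dword (b :: i) ++ dbit (last b i) c :: dword (u ++ j).
  by move=> ->; exact: (dword_cat b i c (u' ++ j)).
rewrite (h _ _ _ sE) (h _ _ _ tE) dsj; congr (_ ++ _ :: _).
have := mem_last b i; rewrite iE mem_filter => /andP[/andP[yn yh] yD].
have : dbit (last b i) (head c0 s) = dbit (last b i) (head c0 t).
  apply: hI => // y' y'D y'n y'h; apply: (ilast _ _ erefl).
  by rewrite mem_filter y'n y'h.
by rewrite sE tE.
Qed.

Definition zconvex (s : seq cell) : Prop :=
  forall x y z, x \in s -> y \in s -> cle x z -> cle z y -> z \in s.

(** The cells placed first are those lying under some cell of [s] for [cle]. By convexity such a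
    cell outside [s] cannot also lie over a cell of [s], so the order conditions of [swap_middle]
    hold and only the junctions remain. *)
Lemma swap_convex (D : diagram) (s t : seq cell) (c0 : cell) :
  ordered s -> ordered t -> s =i t -> {subset s <= D} -> zconvex s ->
  dword s = dword t -> s <> t ->
  (forall y, y \in D -> y \notin s -> has (cle y) s ->
    dbit y (head c0 s) = dbit y (head c0 t)) ->
  (forall z, z \in D -> z \notin s -> ~~ has (cle z) s ->
    (forall z', z' \in D -> z' \notin s -> ~~ has (cle z') s -> (z.1 <= z'.1)%R) ->
    dbit (last c0 s) z = dbit (last c0 t) z) ->
  ~ ddf D.
Proof.
move=> os ot st sD cvx dst neq hI hJ.
apply: (@swap_middle D (fun z => has (cle z) s) s t c0) => //.
- move=> y c yD yn /hasP[c' c's yc'] cs.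
  by apply: contra yn => cy; exact: cvx cs c's cy yc'.
- by move=> c z zD zn zh cs; apply: contra zh => zc; apply/hasP; exists c.
- move=> y z yD zD /hasP[c cs yc]; apply: contra => zy.
  by apply/hasP; exists c => //; exact: cle_trans yc.
- by move=> y yD yn yh _; exact: hI.
Qed.

(** Common first and last cells make both junctions agree whatever surrounds the pattern, so such a
    pattern is forbidden in every larger diagram. *)
Lemma swap_robust (D : diagram) (s t : seq cell) (c0 : cell) :
  ordered s -> ordered t -> s =i t -> {subset s <= D} -> zconvex s ->
  dword s = dword t -> s <> t -> head c0 s = head c0 t -> last c0 s = last c0 t ->
  ~ ddf D.
Proof.
move=> os ot st sD cvx dst neq hst lst.
by apply: (@swap_convex D s t c0) => // *; rewrite ?hst ?lst.
Qed.

(** * Translation, rotation and transposition *)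

Lemma pairwise_rev (T : Type) (r : rel T) (s : seq T) :
  pairwise r (rev s) = pairwise (fun x y => r y x) s.
Proof.
by elim: s => //= x s IHs; rewrite rev_cons pairwise_rcons all_rev IHs.
Qed.

Lemma size_dword s : size (dword s) = (size s).-1.
Proof. by case: s => //= x s; rewrite size_pairmap. Qed.

Lemma nth_dword x0 s i : i.+1 < size s ->
  nth false (dword s) i = dbit (nth x0 s i) (nth x0 s i.+1).
Proof. by case: s => //= x s lt_i; rewrite (nth_pairmap x0) // -nth_behead. Qed.

Lemma ordered_index s : ordered s ->
  {in s &, forall x y, cle x y -> index x s <= index y s}.
Proof.
move=> os x y xs ys; case: leqP => // lt_yx.
have := pairwiseP x os (index y s) (index x s).
by rewrite !inE !index_mem !nth_index // => /(_ ys xs lt_yx) /negbTE ->.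
Qed.

Lemma index_ordered s : uniq s ->
  {in s &, forall x y, cle x y -> index x s <= index y s} -> ordered s.
Proof.
case: s => // x0 s us h; apply/(pairwiseP x0) => i j; rewrite !inE => lt_i lt_j lt_ij.
apply/negP => /(h _ _ (mem_nth x0 lt_j) (mem_nth x0 lt_i)).
by rewrite !index_uniq // leqNgt lt_ij.
Qed.

Lemma mem_transpose D c : (c \in transpose D) = ((c.2, c.1) \in D).
Proof.
apply/imfsetP/idP => [[d dD ->]|cD]; first by case: d dD.
by exists (c.2, c.1) => //; case: c {cD}.
Qed.

Lemma mem_rotate D c : (c \in rotate D) = ((- c.1, - c.2)%R \in D).
Proof.
apply/imfsetP/idP => [[d dD ->]|cD]; first by case: d dD => a b; rewrite /= !opprK.
by exists (- c.1, - c.2)%R => //; case: c {cD} => a b; rewrite /= !opprK.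
Qed.

Lemma mem_translate v D c : (c \in translate v D) = ((c.1 - v.1, c.2 - v.2)%R \in D).
Proof.
apply/imfsetP/idP => [[d dD ->]|cD]; first by case: d dD => a b; rewrite /= !addrK.
by exists (c.1 - v.1, c.2 - v.2)%R => //; case: c {cD} => a b; rewrite /= !subrK.
Qed.

Lemma transposeK : involutive transpose.
Proof. by move=> D; apply/fsetP => -[a b]; rewrite !mem_transpose. Qed.

Lemma rotateK : involutive rotate.
Proof. by move=> D; apply/fsetP => -[a b]; rewrite !mem_rotate /= !opprK. Qed.

Lemma convex_transpose D : convex D -> convex (transpose D).
Proof.
move=> cD x y z; rewrite !mem_transpose => xD yD xz zy.
by apply: cD xD yD _ _; move: xz zy; rewrite /cle /=; lia.
Qed.

Lemma convex_rotate D : convex D -> convex (rotate D).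
Proof.
move=> cD x y z; rewrite !mem_rotate => xD yD xz zy.
by apply: cD yD xD _ _; move: xz zy; rewrite /cle /=; lia.
Qed.

Lemma ddf_translate v D : ddf D -> ddf (translate v D).
Proof.
pose f (c : cell) : cell := (c.1 - v.1, c.2 - v.2)%R.
have inj_f : injective f by move=> [a b] [c d] [] *; congr pair; lia.
have fl s : linext (translate v D) s -> linext D (map f s).
  case=> os sE; split.
    rewrite /ordered pairwise_map; apply: sub_pairwise os => x y /=.
    by apply: contra; rewrite /cle /f /=; lia.
  move=> c; have -> : c = f (c.1 + v.1, c.2 + v.2)%R.
    by case: c => a b; rewrite /f /= !addrK.
  by rewrite (mem_map inj_f) sE mem_translate.
have fd s : dword (map f s) = dword s.
  apply: (@eq_from_nth _ false) => [|i]; rewrite !size_dword size_map // => lt_i.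
  have {}lt_i : i.+1 < size s by lia.
  rewrite !(nth_dword (0, 0)%R) ?size_map // !(nth_map (0, 0)%R) ?(ltnW lt_i) //.
  by rewrite /dbit /f /= ltrD2r.
move=> ddfD s t ls lt e; apply: (inj_map inj_f).
by apply: ddfD (fl _ ls) (fl _ lt) _; rewrite !fd.
Qed.

Lemma ddf_rotate D : ddf D -> ddf (rotate D).
Proof.
pose f (c : cell) : cell := (- c.1, - c.2)%R.
have fK : involutive f by move=> [a b]; rewrite /f /= !opprK.
have fl s : linext (rotate D) s -> linext D (rev (map f s)).
  case=> os sE; split.
    rewrite /ordered pairwise_rev pairwise_map; apply: sub_pairwise os => x y /=.
    by apply: contra; rewrite /cle /f /=; lia.
  move=> c; rewrite mem_rev -[c]fK (mem_map (can_inj fK)) sE mem_rotate.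
  by rewrite -/(f (f c)) fK.
have fd s : dword (rev (map f s)) = rev (dword s).
  apply: (@eq_from_nth _ false) => [|i].
    by rewrite size_rev !size_dword size_rev size_map.
  rewrite size_dword size_rev size_map => lt_i.
  have [lt1 lt2 lt3 lt4] : [/\ i.+1 < size s, i < size s, size s - i.+1 < size s
    & size s - i.+2 < size s] by split; lia.
  rewrite (nth_dword (0, 0)%R) ?size_rev ?size_map //.
  rewrite !nth_rev ?size_map ?size_dword // !(nth_map (0, 0)%R) //.
  rewrite (nth_dword (0, 0)%R); last by lia.
  have -> : size s - i.+1 = ((size s).-1 - i.+1).+1 by lia.
  have -> : size s - i.+2 = (size s).-1 - i.+1 by lia.
  by rewrite /dbit /f /= ltrN2.
move=> ddfD s t ls lt e; apply: (inj_map (can_inj fK)); apply: (can_inj revK).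
by apply: ddfD (fl _ ls) (fl _ lt) _; rewrite !fd e.
Qed.

(** If both coordinates increased from one cell to the next, the corner [(c.1, d.2)] would belong to
    [D] by convexity and would have to be listed strictly between two consecutive cells. *)
Lemma linext_next D s x0 i : convex D -> linext D s -> i.+1 < size s ->
  dbit (nth x0 s i) (nth x0 s i.+1) = ~~ ((nth x0 s i).2 < (nth x0 s i.+1).2)%R.
Proof.
move=> cD [os sE] lt_i; set c := nth x0 s i; set d := nth x0 s i.+1.
have us := ordered_uniq os.
have cs : c \in s by rewrite mem_nth // ltnW.
have ds : d \in s by rewrite mem_nth.
have ic : index c s = i by rewrite index_uniq // ltnW.
have id : index d s = i.+1 by rewrite index_uniq.
have ndc : ~~ cle d c.
  by apply/negP => /(ordered_index os ds cs); rewrite ic id ltnn.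
apply/idP/idP => [rcd|]; last by move: ndc; rewrite /cle /dbit; lia.
apply/negP => ccd; pose e : cell := (c.1, d.2).
have ce : cle c e by rewrite /cle /e /=; lia.
have ed : cle e d by move: rcd; rewrite /dbit /cle /e /=; lia.
have es : e \in s by rewrite sE; apply: cD ce ed; rewrite -sE.
have := ordered_index os cs es ce; have := ordered_index os es ds ed.
rewrite ic id => le1 le2.
have : (index e s == i) || (index e s == i.+1) by lia.
case/orP => /eqP ie; have := nth_index x0 es; rewrite ie -/c -/d => eE.
  by move: ccd; rewrite eE /e /= ltxx.
by move: rcd; rewrite /dbit eE /e /= ltxx.
Qed.

Lemma ddf_transpose D : convex D -> ddf D -> ddf (transpose D).
Proof.
move=> cD.
pose f (c : cell) : cell := (c.2, c.1).
have fK : involutive f by case.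
have fl s : linext (transpose D) s -> linext D (map f s).
  case=> os sE; split.
    rewrite /ordered pairwise_map; apply: sub_pairwise os => x y /=.
    by apply: contra; rewrite /cle /f /=; lia.
  by move=> c; rewrite -[c]fK (mem_map (can_inj fK)) sE mem_transpose.
(* By [linext_next], the column rises exactly where the row does not, so exchanging coordinates
   complements the word. *)
have fd s : linext (transpose D) s -> dword (map f s) = map negb (dword s).
  move=> ls; apply: (@eq_from_nth _ false) => [|i].
    by rewrite !(size_map, size_dword).
  rewrite size_dword size_map => lt_i.
  have {}lt_i : i.+1 < size s by lia.
  rewrite (nth_map false) ?size_dword; last by lia.
  rewrite !(nth_dword (0, 0)%R) ?size_map // !(nth_map (0, 0)%R) ?(ltnW lt_i) //.
  by rewrite (linext_next _ (convex_transpose cD) ls lt_i) negbK.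
move=> ddfD s t ls lt e; apply: (inj_map (can_inj fK)).
by apply: ddfD (fl _ ls) (fl _ lt) _; rewrite !fd // e.
Qed.

(** * Extremal cells *)

Definition maximal (D : diagram) (x : cell) : bool :=
  all (fun y => cle x y ==> (y == x)) D.

Lemma maximalP D x : reflect (forall y, y \in D -> cle x y -> y = x) (maximal D x).
Proof.
apply: (iffP allP) => h y yD; first by move=> xy; apply/eqP; move: (h y yD); rewrite xy.
by apply/implyP => /(h y yD) ->.
Qed.

(* Listing a, b, c last, the words bca and acb share their descents, and so do
   cab and bac. Whether the preceding cell is a descent is monotone in the row of
   the next cell, hence takes equal values on a, b or on b, c. *)
Lemma three_maximal (D : diagram) (a b c : cell) :
  a \in D -> b \in D -> c \in D -> maximal D a -> maximal D b -> maximal D c ->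
  (a.1 < b.1)%R -> (b.1 < c.1)%R -> ~ ddf D.
Proof.
move=> aD bD cD /maximalP ma /maximalP mb /maximalP mc ab bc.
have nab : ~~ cle a b by apply/negP => /(ma _ bD) e; move: ab; rewrite e ltxx.
have nbc : ~~ cle b c by apply/negP => /(mb _ cD) e; move: bc; rewrite e ltxx.
have nac : ~~ cle a c.
  by apply/negP => /(ma _ cD) e; move: bc; rewrite e => /(lt_trans ab); rewrite ltxx.
have [nba nca ncb] : [/\ ~~ cle b a, ~~ cle c a & ~~ cle c b].
  by split; rewrite /cle; lia.
(* [rho] is the row of the lowest remaining cells, the only datum on which the junction before the
   three cells depends; if no cell remains its value is arbitrary. *)
have [rho rhoP] : exists rho : int, forall y, y \in D -> y \notin [:: a; b; c] ->
    (forall y', y' \in D -> y' \notin [:: a; b; c] -> (y'.1 <= y.1)%R) -> y.1 = rho.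
  have [[|x i] [_ iE _ ilast]] := row_major
    (filter_uniq (fun z => z \notin [:: a; b; c]) (fset_uniq D)).
    by exists 0%R => y yD yn; have := iE y; rewrite mem_filter yn yD.
  exists (last x i).1 => y yD yn ymax; apply/eqP; rewrite eq_le.
  rewrite (ilast _ _ erefl) ?mem_filter ?yn //=.
  by have := mem_last x i; rewrite iE mem_filter => /andP[? ?]; apply: ymax.
have key s t : perm_eq s [:: a; b; c] -> perm_eq t s -> ordered s -> ordered t ->
    dword s = dword t -> s <> t ->
    (rho < (head a s).1)%R = (rho < (head a t).1)%R -> ~ ddf D.
  move=> sE ts os ot dst neq hst.
  have mx x : x \in s -> forall y, y \in D -> cle x y -> y = x.
    by rewrite (perm_mem sE) !inE => /or3P[]/eqP->.
  have sD : {subset s <= D} by move=> x; rewrite (perm_mem sE) !inE => /or3P[]/eqP->.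
  (* All other cells come first, which is allowed because nothing lies over a maximal cell; there is
     then no junction on the right. *)
  apply: (@swap_middle D predT s t a) => //.
  - by move=> x; rewrite (perm_mem ts).
  - by move=> y x yD yn _ xs; apply: contra yn => /(mx x xs y yD) ->.
  - move=> y yD yn _ ymax; rewrite /dbit (rhoP y) //.
      by rewrite -(perm_mem sE).
    by move=> y' y'D y'n; apply: ymax; rewrite ?(perm_mem sE).
case: (boolP ((rho < b.1)%R == (rho < a.1)%R)) => [/eqP e|ne].
  apply: (key [:: b; c; a] [:: a; c; b]) => //=.
  - by rewrite (perm_catC [:: b; c] [:: a]).
  - by apply/permP => p /=; clear; lia.
  - by rewrite /ordered /= ?nab ?nbc ?nac ?nba ?nca ?ncb.
  - by rewrite /ordered /= ?nab ?nbc ?nac ?nba ?nca ?ncb.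
  - by rewrite /dbit; congr [:: _; _]; move: ab bc; clear; lia.
  - by case=> e'; move: ab; rewrite e' ltxx.
apply: (key [:: c; a; b] [:: b; a; c]) => //=.
- by rewrite (perm_catC [:: c] [:: a; b]).
- by apply/permP => p /=; clear; lia.
- by rewrite /ordered /= ?nab ?nbc ?nac ?nba ?nca ?ncb.
- by rewrite /ordered /= ?nab ?nbc ?nac ?nba ?nca ?ncb.
- by rewrite /dbit; congr [:: _; _]; move: ab bc; clear; lia.
- by case=> e'; move: bc; rewrite e' ltxx.
- by move: ne ab bc; clear; lia.
Qed.

Lemma seq_argmax (T : eqType) (f : T -> int) (s : seq T) (x : T) : x \in s ->
  exists2 y, y \in s & {in s, forall z, (f z <= f y)%R}.
Proof.
elim: s x => // a [_ x _|b s IHs x _].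
  by exists a; rewrite ?mem_head // => z; rewrite inE => /eqP ->.
have [y ys yP] := IHs b (mem_head _ _).
case: (lerP (f a) (f y)) => [ay|ya]; [exists y|exists a]; rewrite ?mem_head //.
- by rewrite inE ys orbT.
- by move=> z; rewrite inE => /predU1P[->//|/yP].
- move=> z; rewrite inE => /predU1P[->//|/yP zy]; exact: le_trans zy (ltW ya).
Qed.

(** A cell of largest coordinate sum among those over [x] is maximal. *)
Lemma below_maximal D x : x \in D -> exists y, [/\ y \in D, maximal D y & cle x y].
Proof.
move=> xD; have := @seq_argmax _ (fun z : cell => z.1 + z.2)%R [seq z <- D | cle x z] x.
rewrite mem_filter cle_refl xD => /(_ isT) [y]; rewrite mem_filter => /andP[xy yD] ymax.
exists y; split=> //; apply/maximalP => z zD yz.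
have := ymax z; rewrite mem_filter zD (cle_trans xy yz) => /(_ isT).
move=> h; apply: cle_anti => //; case: z y h yz {ymax yD xy zD} => [a b] [c d].
by rewrite /cle /=; clear; lia.
Qed.

(** Distinct maximal cells are incomparable, so their rows differ. Take the highest and the lowest
    of them; any further one would lie strictly between and contradict [three_maximal]. *)
Lemma maximal_pair D x0 : x0 \in D -> ddf D -> exists M1 M2 : cell,
  [/\ M1 \in D, M2 \in D,
      M1 = M2 \/ (M1.1 < M2.1)%R /\ (M2.2 < M1.2)%R
    & forall x, x \in D -> cle x M1 || cle x M2].
Proof.
move=> x0D ddfD.
have [[|M1 i] [_ iE ihead ilast]] := row_major (filter_uniq (maximal D) (fset_uniq D)).
  by have [y [yD ymax _]] := below_maximal x0D; have := iE y; rewrite mem_filter ymax yD.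
have inc x y : x \in D -> y \in D -> maximal D x -> maximal D y -> x != y ->
    (x.1 <= y.1)%R -> (x.1 < y.1)%R /\ (y.2 < x.2)%R.
  move=> xD yD /maximalP mx /maximalP my ne xy.
  have nxy : ~~ cle x y by apply: contra ne => /(mx y yD) ->.
  have nyx : ~~ cle y x by apply: contra ne => /(my x xD) ->.
  case: x y nxy nyx xy {xD yD mx my ne} => [a b] [c d]; rewrite /cle /=; clear; lia.
pose M2 := last M1 i.
have := mem_head M1 i; rewrite iE mem_filter => /andP[mM1 M1D].
have := mem_last M1 i; rewrite iE mem_filter -/M2 => /andP[mM2 M2D].
exists M1, M2; split=> //.
  case: (eqVneq M1 M2) => [|ne]; [by left | right].
  by apply: inc => //; apply: (ihead _ _ erefl); rewrite mem_filter mM2.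
move=> x xD; have [M [MD mM xM]] := below_maximal xD.
case: (eqVneq M M1) => [<-|ne1]; first by rewrite xM.
case: (eqVneq M M2) => [<-|ne2]; first by rewrite xM orbT.
have [] : ~ ddf D; last by [].
apply: (three_maximal M1D MD M2D) => //.
- apply: (proj1 (inc _ _ _ _ _ _ _ _)) => //; first by rewrite eq_sym.
  by apply: (ihead _ _ erefl); rewrite mem_filter mM.
- apply: (proj1 (inc _ _ _ _ _ _ _ _)) => //.
  by apply: (ilast _ _ erefl); rewrite mem_filter mM.
Qed.

Definition hull (m1 m2 M1 M2 x : cell) : bool :=
  (cle m1 x || cle m2 x) && (cle x M1 || cle x M2).

(** The minimal cells come from the maximal cells of the rotated diagram, and convexity fills in
    everything between minimal and maximal cells. *)
Lemma ddf_hull D x0 : convex D -> x0 \in D -> ddf D -> exists m1 m2 M1 M2 : cell,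
  [/\ D =i hull m1 m2 M1 M2, [/\ m1 \in D, m2 \in D, M1 \in D & M2 \in D],
      m1 = m2 \/ (m1.1 < m2.1)%R /\ (m2.2 < m1.2)%R
    & M1 = M2 \/ (M1.1 < M2.1)%R /\ (M2.2 < M1.2)%R].
Proof.
move=> cD x0D ddfD; have [M1 [M2 [M1D M2D Mlt Mge]]] := maximal_pair x0D ddfD.
have rx0 : (- x0.1, - x0.2)%R \in rotate D.
  by rewrite mem_rotate /= !opprK; case: (x0) x0D.
have [n1 [n2 []]] := maximal_pair rx0 (ddf_rotate ddfD).
rewrite !mem_rotate => n1D n2D nlt nge.
(* Rotation reverses the rows, so the indices are exchanged to keep the upper cell first. *)
exists (- n2.1, - n2.2)%R, (- n1.1, - n1.2)%R, M1, M2; split=> //.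
  have mle x : x \in D -> cle (- n2.1, - n2.2)%R x || cle (- n1.1, - n1.2)%R x.
    move=> xD; have := nge (- x.1, - x.2)%R; rewrite mem_rotate /= !opprK.
    case: x xD => a b xD /(_ xD); rewrite /cle /=; clear; lia.
  move=> x; rewrite [in RHS]/in_mem /= /hull; apply/idP/andP.
    by move=> xD; rewrite mle // Mge.
  case=> /orP[] h1 /orP[] h2; apply: (cD _ _ _ _ _ h1 h2) => //.
case: nlt => [->|[h1 h2]]; [by left | right] => /=.
by move: h1 h2; clear; lia.
Qed.

(** * Patterns with two tableaux of equal descents *)

Lemma dword_rows s :
  dword s = if unzip1 s is a :: r then pairmap (fun x y => x < y)%R a r else [::].
Proof. by case: s => //= x s; elim: s x => //= y s IHs x; rewrite IHs. Qed.

Lemma eq_dword s t : unzip1 s = unzip1 t -> dword s = dword t.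
Proof. by rewrite !dword_rows => ->. Qed.

Section Patterns.
Local Open Scope ring_scope.

(** The words exchange the upper right cell of the block with the far cell. Both lie above the
    second row of the block and neither lies below the first, so no bit changes, and the end cells
    are fixed as [swap_robust] demands. *)
Lemma block_northeast (D : diagram) (i j k l : int) : (k < i) -> (j + 1 < l) ->
  {subset [:: (i, j); (i, j + 1); (i + 1, j); (i + 1, j + 1); (k, l)] <= D} -> ~ ddf D.
Proof.
move=> ki jl sD.
pose s : seq cell := [:: (i, j); (i, j + 1); (i + 1, j); (k, l); (i + 1, j + 1)].
pose t : seq cell := [:: (i, j); (k, l); (i + 1, j); (i, j + 1); (i + 1, j + 1)].
apply: (@swap_robust D s t (0, 0)) => //.
- by rewrite /ordered /= /cle /=; move: ki jl; clear; lia.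
- by rewrite /ordered /= /cle /=; move: ki jl; clear; lia.
- by apply/perm_mem/permP => p /=; clear; lia.
- move=> x xs; apply: sD; rewrite -(@perm_mem _ s) //.
  by apply/permP => p /=; clear; lia.
- move=> [x1 x2] [y1 y2] [z1 z2]; rewrite /cle !inE !xpair_eqE /=.
  by move: ki jl; clear; lia.
- by rewrite /= /dbit /=; congr [:: _; _; _; _]; move: ki jl; clear; lia.
- by move=> [] e _; move: ki; rewrite e ltxx.
Qed.

(** Both words have their only descent after the third cell and share their end cells. *)
Lemma long_overlap (D : diagram) (i j : int) :
  {subset [:: (i, j); (i, j + 1); (i, j + 2);
              (i + 1, j - 2); (i + 1, j - 1); (i + 1, j)] <= D} -> ~ ddf D.
Proof.
move=> sD.
pose s : seq cell := [:: (i + 1, j - 2); (i + 1, j - 1); (i, j); (i + 1, j);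
                         (i, j + 1); (i, j + 2)].
pose t : seq cell := [:: (i + 1, j - 2); (i, j); (i, j + 1); (i + 1, j - 1);
                         (i + 1, j); (i, j + 2)].
apply: (@swap_robust D s t (0, 0)) => //.
- by rewrite /ordered /= /cle /=; clear; lia.
- by rewrite /ordered /= /cle /=; clear; lia.
- by apply/perm_mem/permP => p /=; clear; lia.
- move=> x xs; apply: sD; rewrite -(@perm_mem _ s) //.
  by apply/permP => p /=; clear; lia.
- move=> [x1 x2] [y1 y2] [z1 z2]; rewrite /cle !inE !xpair_eqE /=.
  by clear; lia.
- by rewrite /= /dbit /=; congr [:: _; _; _; _; _]; clear; lia.
- by case; clear; lia.
Qed.

(** Both tableaux have descent set {2, 5}. Their last cells lie in different rows, so the conclusion
    is only for the whole diagram; the shape (4,4), which contains this one, is in the list. *)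
Lemma four_three (D : diagram) (i j : int) :
  D =i [:: (i, j); (i, j + 1); (i, j + 2); (i, j + 3);
           (i + 1, j); (i + 1, j + 1); (i + 1, j + 2)] -> ~ ddf D.
Proof.
move=> DE.
pose s : seq cell := [:: (i, j); (i, j + 1); (i + 1, j); (i + 1, j + 1); (i, j + 2);
                         (i + 1, j + 2); (i, j + 3)].
pose t : seq cell := [:: (i, j); (i, j + 1); (i + 1, j); (i, j + 2); (i, j + 3);
                         (i + 1, j + 1); (i + 1, j + 2)].
move=> /(_ s t) ddfD; suff : s = t by case; clear; lia.
apply: ddfD.
- split; first by rewrite /ordered /= /cle /=; clear; lia.
  by move=> x; rewrite DE; apply: perm_mem; apply/permP => p /=; clear; lia.
- split; first by rewrite /ordered /= /cle /=; clear; lia.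
  by move=> x; rewrite DE; apply: perm_mem; apply/permP => p /=; clear; lia.
- by rewrite /= /dbit /=; congr [:: _; _; _; _; _; _]; clear; lia.
Qed.

(** The first two cells of the upper row and the last two of the lower row admit two orders with a
    single descent in the middle. What precedes lies in the lower row and what follows in the upper
    one, so neither junction is a descent in either order. *)
Lemma two_rows (D : diagram) (u1 v1 z1 u2 v2 z2 : int) : u1 < u2 -> z2 < v1 -> v1 < z1 -> v2 < z2 ->
  D =i (fun x : cell => (x.1 == u1) && (v1 <= x.2 <= z1)
                     || (x.1 == u2) && (v2 <= x.2 <= z2)) -> ~ ddf D.
Proof.
move=> lt_u lt_zv lt1 lt2 DE.
have {}DE x y : ((x, y) \in D) = (x == u1) && (v1 <= y <= z1) || (x == u2) && (v2 <= y <= z2).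
  by rewrite DE.
pose s : seq cell := [:: (u1, v1); (u1, v1 + 1); (u2, z2 - 1); (u2, z2)].
pose t : seq cell := [:: (u2, z2 - 1); (u1, v1); (u2, z2); (u1, v1 + 1)].
apply: (@swap_convex D s t (0, 0)) => //.
- by rewrite /ordered /= /cle /=; move: lt_u lt_zv; clear; lia.
- by rewrite /ordered /= /cle /=; move: lt_u lt_zv; clear; lia.
- by apply/perm_mem/permP => p /=; clear; lia.
- move=> [x y]; rewrite !inE !xpair_eqE DE; move: lt1 lt2; clear; lia.
- move=> [x1 x2] [y1 y2] [a b]; rewrite /cle !inE !xpair_eqE /=.
  by move: lt_u lt_zv; clear; lia.
- by rewrite /= /dbit /=; congr [:: _; _; _]; move: lt_u; clear; lia.
- by case; move: lt_u; clear; lia.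
- move=> [x y]; rewrite DE !inE !xpair_eqE /cle /dbit /=.
  by move: lt_u lt_zv; clear; lia.
- move=> [x y]; rewrite DE !inE !xpair_eqE /cle /dbit /= => *.
  by apply/idP/idP; lia.
Qed.
End Patterns.

Lemma block_southwest D (i j k l : int) : (i + 1 < k)%R -> (l < j)%R ->
  {subset [:: (i, j); (i, j + 1); (i + 1, j); (i + 1, j + 1); (k, l)]%R <= D} -> ~ ddf D.
Proof.
move=> ik lj sD /ddf_rotate.
apply: (@block_northeast (rotate D) (- i - 1) (- j - 1) (- k) (- l)); try lia.
move=> [x y] xy; rewrite mem_rotate; apply: sD; move: xy.
by rewrite !inE !xpair_eqE /=; clear; lia.
Qed.

(* With A and X the first two cells of the top row, L the inner cells of the column
   below A, E its bottom cell and Y the left neighbour of E, the orders A X L Y E and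
   Y A L E X have equal descents. *)
Lemma z_shape (D : diagram) (u1 v1 z1 u2 v2 z2 : int) :
  (u1 < u2)%R -> (v2 < v1)%R -> (v1 <= z2)%R -> (z2 < z1)%R ->
  D =i hull (u1, v1) (u2, v2) (u1, z1) (u2, z2) -> ~ ddf D.
Proof.
move=> lt_u lt_v le_vz lt_z DE.
have {}DE x y : ((x, y) \in D) = ((u1 <= x) && (v1 <= y) || (u2 <= x) && (v2 <= y))%R &&
     ((x <= u1) && (y <= z1) || (x <= u2) && (y <= z2))%R.
  by rewrite DE.
have [L [oL LE _ _]] := row_major
  (filter_uniq (fun x : cell => (x.2 == v1) && (u1 < x.1 < u2)%R) (fset_uniq D)).
have {}LE x y : ((x, y) \in L) = (y == v1) && (u1 < x < u2)%R.
  by rewrite LE mem_filter DE /=; apply/idP/idP; move: lt_u lt_v le_vz; clear; lia.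
pose A : cell := (u1, v1); pose X : cell := (u1, v1 + 1)%R.
pose Y : cell := (u2, v1 - 1)%R; pose E : cell := (u2, v1).
pose s := [:: A; X] ++ L ++ [:: Y; E]; pose t := [:: Y; A] ++ L ++ [:: E; X].
have stp : perm_eq s t.
  by apply/permP => p; rewrite /s /t !count_cat /=; clear; lia.
have sE x y : ((x, y) \in s) = [|| (x == u1) && (y == v1), (x == u1) && (y == v1 + 1)%R,
    (y == v1) && (u1 < x < u2)%R, (x == u2) && (y == v1 - 1)%R | (x == u2) && (y == v1)].
  by rewrite /s !mem_cat LE !inE !xpair_eqE !orbA.
have sh x y : has (cle (x, y)) s =
    [|| (x <= u1)%R && (y <= v1 + 1)%R | (x <= u2)%R && (y <= v1)%R].
  apply/idP/idP => [/hasP[[a b]]|h].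
    by rewrite sE /cle /=; move: lt_u; clear; lia.
  apply/hasP; case/orP: h => h; [exists X | exists E]; rewrite ?sE ?eqxx ?orbT //.
apply: (@swap_convex D s t (0, 0)%R) => //.
- rewrite /ordered /s !pairwise_cat; move: oL; rewrite /ordered => ->.
  apply/andP; split.
    apply/allrelP => -[a b] [c d]; rewrite mem_cat LE !inE !xpair_eqE /cle /=.
    by move: lt_u; clear; lia.
  apply/andP; split; first by rewrite /= /cle /=; clear; lia.
  rewrite /= andbT; apply/andP; split; last by rewrite /cle /=; clear; lia.
  apply/allrelP => -[a b] [c d]; rewrite LE !inE !xpair_eqE /cle /=.
  by move: lt_u; clear; lia.
- rewrite /ordered /t !pairwise_cat; move: oL; rewrite /ordered => ->.
  apply/andP; split.
    apply/allrelP => -[a b] [c d]; rewrite mem_cat LE !inE !xpair_eqE /cle /=.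
    by move: lt_u; clear; lia.
  apply/andP; split; first by rewrite /= /cle /=; move: lt_u; clear; lia.
  rewrite /= andbT; apply/andP; split; last by rewrite /cle /=; move: lt_u; clear; lia.
  apply/allrelP => -[a b] [c d]; rewrite LE !inE !xpair_eqE /cle /=.
  by move: lt_u; clear; lia.
- exact: perm_mem.
- move=> [x y]; rewrite sE DE; move: lt_u lt_v le_vz lt_z; clear; lia.
- move=> [x1 x2] [y1 y2] [a b]; rewrite !sE /cle /=.
  by move: lt_u; clear; lia.
- have dL : dword ([:: A] ++ L ++ [:: E]) = dword ([:: X] ++ L ++ [:: Y]).
    by apply: eq_dword; rewrite /unzip1 !map_cat.
  have ->: dword s = false :: rcons (dword ([:: X] ++ L ++ [:: Y])) false.
    by rewrite /s /= /dbit /= ltxx !pairmap_cat /= -cats1 -catA /= ltxx.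
  have ->: dword t = false :: rcons (dword ([:: A] ++ L ++ [:: E])) false.
    rewrite /t /= /dbit /= (lt_gtF lt_u) !pairmap_cat /= -cats1 -catA /=.
    by rewrite (lt_gtF lt_u).
  by rewrite dL.
- by rewrite /s /t => -[]; move: lt_u; clear; lia.
- move=> [x y]; rewrite DE sE sh /dbit /= => *.
  by apply/idP/idP; lia.
- have ls : last (0, 0)%R s = E by rewrite /s !last_cat.
  have lt : last (0, 0)%R t = X by rewrite /t !last_cat.
  move=> [x y] zD zn zh zmin; move: zD zn zh.
  rewrite DE sE sh ls lt /dbit /= => zD zn zh.
  (* If the top row goes beyond [X], the first later cell lies in that row and is a descent neither
     after [E] nor after [X]. Otherwise no cell is left to follow. *)
  case: (ltrP (v1 + 1) z1) => [lt_vz|le]; last first.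
    by move: zD zn zh le le_vz lt_z lt_v lt_u; clear; lia.
  have xu1 : (x <= u1)%R.
    apply: (zmin (u1, v1 + 2)%R); rewrite ?DE ?sE ?sh /=;
      by move: lt_vz lt_u lt_v le_vz lt_z; clear; lia.
  have -> : x = u1 by move: xu1 zD lt_u; clear; lia.
  by rewrite /= ltxx lt_gtF.
Qed.

(** * The classification *)

Lemma mem_young la (i j : int) :
  ((i, j) \in young la) = [&& (0 <= i)%R, (0 <= j)%R & `|j|%N < nth 0 la `|i|%N].
Proof.
rewrite in_fset; apply/allpairsPdep/idP => [[a [b [+ + [-> ->]]]]|].
  by rewrite !mem_iota /= !add0n.
case: i j => [i|//] [j|//] /= lt; exists i, j; rewrite !mem_iota /= !add0n; split=> //.
by rewrite ltnNge; apply/negP => /(nth_default 0) e; rewrite e in lt.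
Qed.

Lemma card_young la : #|` young la| = sumn la.
Proof.
pose s : seq cell := [seq ((i%:Z)%R, (j%:Z)%R) | i <- iota 0 (size la), j <- iota 0 (nth 0 la i)].
have us : uniq s.
  apply: allpairs_uniq_dep => [|i _|]; rewrite ?iota_uniq //.
  by move=> [a b] [c d] _ _ [-> ->].
have sE : young la =i s by move=> c; rewrite in_fset.
rewrite (perm_size (uniq_perm (fset_uniq _) us sE)) size_allpairs_dep.
congr sumn; under eq_map => i do rewrite size_iota.
exact: mkseq_nth.
Qed.

Lemma card_translate v D : #|` translate v D| = #|` D|.
Proof.
rewrite card_imfset // => -[a b] [c d] /= [e1 e2].
by congr pair; move: e1 e2; clear; lia.
Qed.

(** Recognises a translated Young diagram, and its size, from a membership test in coordinates; the
    absolute values turn integer offsets into row and column indices. *)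
Lemma young_shape (D : diagram) la (u v : int) :
  (forall x y, ((x, y) \in D) = [&& (u <= x)%R, (v <= y)%R
                              & `|y - v|%N < nth 0 la `|x - u|%N]) ->
  same_shape D (young la) /\ #|` D| = sumn la.
Proof.
move=> DE; have e : D = translate (u, v) (young la).
  by apply/fsetP => -[x y]; rewrite mem_translate DE mem_young /= !subr_ge0.
by split; [exists (u, v) | rewrite {1}e card_translate card_young].
Qed.

Lemma in_list_hook (D : diagram) (u v w z : int) : (u <= w)%R -> (v <= z)%R ->
  (forall x y, ((x, y) \in D) = [&& u <= x, x <= w, v <= y, y <= z & (x == u) || (y == v)]%R) ->
  in_list #|` D| D.
Proof.
move=> uw vz DE; right; right; right; left.
have [sh cD] : same_shape D (young (`|z - v|.+1 :: nseq `|w - u| 1)) /\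
               #|` D| = sumn (`|z - v|.+1 :: nseq `|w - u| 1)%N.
  apply: (@young_shape _ _ u v) => x y; rewrite DE.
  case E: `|x - u|%N => [|k] /=.
    by apply/idP/idP; move: E uw vz; clear; lia.
  rewrite nth_nseq; case: (ltnP k) => h; apply/idP/idP; move: h E uw vz; clear; lia.
move: cD; rewrite /= sumn_nseq mul1n => cD.
split; first by rewrite cD.
exists `|w - u|%N; rewrite cD; split; first by move: uw; clear; lia.
by have -> : `|z - v|.+1 + `|w - u| - `|w - u| = `|z - v|.+1 by rewrite addnK.
Qed.

Lemma in_list_two (D : diagram) (u v z : int) : (v + 1 <= z)%R ->
  (forall x y, ((x, y) \in D) = [|| (x == u) && (v <= y <= z) |
                                    (x == u + 1) && (v <= y <= v + 1)]%R) ->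
  in_list #|` D| D.
Proof.
move=> vz DE; right; right; left.
have [sh cD] : same_shape D (young [:: `|z - v|.+1; 2]) /\
               #|` D| = sumn [:: `|z - v|.+1; 2]%N.
  apply: (@young_shape _ _ u v) => x y; rewrite DE.
  case E: `|x - u|%N => [|[|k]] /=; rewrite ?nth_nil; apply/idP/idP; move: E vz; clear; lia.
move: cD; rewrite /= addn0 => cD; split; first by rewrite cD; move: vz; clear; lia.
by rewrite cD addnK.
Qed.

Lemma in_list_rectangle (D : diagram) (u v z : int) : (z = v + 2 \/ z = v + 3)%R ->
  (forall x y, ((x, y) \in D) = (u <= x <= u + 1) && (v <= y <= z))%R ->
  in_list #|` D| D.
Proof.
move=> zE DE.
have [sh cD] : same_shape D (young [:: `|z - v|.+1; `|z - v|.+1]) /\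
               #|` D| = sumn [:: `|z - v|.+1; `|z - v|.+1]%N.
  apply: (@young_shape _ _ u v) => x y; rewrite DE.
  case E: `|x - u|%N => [|[|k]] /=; rewrite ?nth_nil; apply/idP/idP; move: E zE; clear; lia.
case: zE cD sh => -> cD sh; [left | right; left]; rewrite cD.
  by move: sh; have -> : absz (v + 2 - v)%R = 2 by lia.
by move: sh; have -> : absz (v + 3 - v)%R = 3 by lia.
Qed.

Lemma in_list_dsum (D : diagram) (u1 v1 w1 u2 v2 z2 : int) :
  (u1 <= w1)%R -> (w1 < u2)%R -> (v2 <= z2)%R -> (z2 < v1)%R ->
  (forall x y, ((x, y) \in D) = [|| (u1 <= x <= w1) && (y == v1) |
                                    (x == u2) && (v2 <= y <= z2)]%R) ->
  in_list #|` D| D.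
Proof.
move=> uw wu vz zv DE; right; right; right; right.
pose k := `|w1 - u1|.+1; pose r := `|z2 - v2|.+1.
pose D1 := translate (u2, v2) (young [:: r]); pose D2 := translate (u1, v1) (young (nseq k 1)).
have D1E x y : ((x, y) \in D1) = ((x == u2) && (v2 <= y <= z2))%R.
  rewrite mem_translate mem_young /=.
  case E: `|x - u2|%N => [|j] /=; rewrite ?nth_nil;
    by apply/idP/idP; move: E vz; rewrite /r; clear; lia.
have D2E x y : ((x, y) \in D2) = ((u1 <= x <= w1) && (y == v1))%R.
  rewrite mem_translate mem_young nth_nseq /=.
  case: (ltnP _ k) => h; apply/idP/idP; move: h uw; rewrite /k; clear; lia.
have eD : D = D1 `|` D2.
  by apply/fsetP => -[x y]; rewrite in_fsetU D1E D2E DE orbC.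
have eI : D1 `&` D2 = fset0.
  by apply/fsetP => -[x y]; rewrite in_fsetI D1E D2E in_fset0; apply/negP; move: wu; clear; lia.
have cD : #|` D| = (r + k)%N.
  rewrite eD cardfsU eI cardfs0 subn0 !card_translate !card_young /= addn0.
  by rewrite sumn_nseq mul1n.
exists k; rewrite cD; split; first by rewrite /k /r; clear; lia.
rewrite addnK; exists (u2, v2), (u1, v1); split=> //.
move=> [a b] [c d]; rewrite -/D1 -/D2 D1E D2E /=; move: wu zv uw vz; clear; lia.
Qed.

Definition listed (n : nat) (D : diagram) : Prop :=
  in_list_up_to_transpose n D \/ in_list_up_to_transpose n (rotate D).

Lemma listed_rotate n D : listed n (rotate D) -> listed n D.
Proof. by rewrite /listed rotateK; case; [right | left]. Qed.

Lemma card_transpose D : #|` transpose D| = #|` D|.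
Proof. by rewrite card_imfset // => -[a b] [c d] /= [-> ->]. Qed.

Lemma card_rotate D : #|` rotate D| = #|` D|.
Proof.
by rewrite card_imfset // => -[a b] [c d] /= [/oppr_inj -> /oppr_inj ->].
Qed.

(** * Case analysis on the rectangles spanned by the extremal cells *)

Section Classification.
Local Open Scope ring_scope.

(** With at least three rows and columns, the block in rows [u + 1], [u + 2] has a cell strictly to
    its north-east. Two rows of length at least five contain the overlapping rows of [long_overlap],
    sharing column [v + 2]. The rest is listed. *)
Lemma ddf_wide_rectangle (D : diagram) (u v w z : int) :
  u <= w -> v <= z -> w - u <= z - v ->
  (forall x y, ((x, y) \in D) = (u <= x <= w) && (v <= y <= z)) ->
  ddf D -> in_list #|` D| D.
Proof.
move=> uw vz wz DE dD.
have [wu|] := boolP (w == u).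
  apply: (@in_list_hook D u v w z) => // x y; rewrite DE.
  by apply/idP/idP; move: wu; clear; lia.
have [w1 _|] := boolP (w == u + 1).
  have [z1|] := boolP (z == v + 1).
    apply: (@in_list_two D u v z) => [|x y]; first by move: z1; clear; lia.
    by rewrite DE; apply/idP/idP; move: w1 z1; clear; lia.
  have [z23 _|] := boolP ((z == v + 2) || (z == v + 3)).
    apply: (@in_list_rectangle D u v z) => [|x y]; first by move: z23; clear; lia.
    by rewrite DE; apply/idP/idP; move: w1; clear; lia.
  move=> h1 h2; exfalso; apply: (@long_overlap D u (v + 2)) dD => -[x y].
  by rewrite !inE !xpair_eqE DE; move: w1 wz h1 h2; clear; lia.
move=> h1 h2; exfalso; apply: (@block_northeast D (u + 1) v u (v + 2)) dD.
- by clear; lia.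
- by clear; lia.
- by move=> [x y]; rewrite !inE !xpair_eqE DE; move: uw wz h1 h2; clear; lia.
Qed.

Lemma ddf_rectangle (D : diagram) (u v w z : int) : convex D -> u <= w -> v <= z ->
  (forall x y, ((x, y) \in D) = (u <= x <= w) && (v <= y <= z)) ->
  ddf D -> listed #|` D| D.
Proof.
move=> cD uw vz DE dD; case: (lerP (w - u) (z - v)) => wz.
  by left; left; exact: ddf_wide_rectangle DE dD.
left; right; rewrite -card_transpose.
apply: (@ddf_wide_rectangle _ v u z w) => //; first exact: ltW.
  by move=> x y; rewrite mem_transpose DE andbC.
exact: ddf_transpose.
Qed.

(** Here only the top row sticks out. If the rows below it are at least two in number and in width,
    they contain a block south-west of the end of the top row. A single row of length at least three
    below it gives (4,3) or a long overlap. *)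
Lemma ddf_row_hook (D : diagram) (u v z1 w2 z2 : int) :
  u < w2 -> v <= z2 -> z2 < z1 ->
  (forall x y, ((x, y) \in D) = [&& u <= x, v <= y &
                                (x <= u) && (y <= z1) || (x <= w2) && (y <= z2)]) ->
  ddf D -> in_list #|` D| D.
Proof.
move=> uw vz zz DE dD.
have [z2v|h1] := boolP (z2 == v).
  apply: (@in_list_hook D u v w2 z1) => [||x y]; rewrite ?DE.
  - exact: ltW.
  - by move: z2v zz; clear; lia.
  - by apply/idP/idP; move: z2v uw zz; clear; lia.
have [w2u|h2] := boolP (w2 == u + 1); last first.
  exfalso; apply: (@block_northeast D (u + 1) v u z1) dD.
  - by clear; lia.
  - by move: vz zz h1; clear; lia.
  - by move=> [x y]; rewrite !inE !xpair_eqE DE; move: uw vz zz h1 h2; clear; lia.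
have [z2v|h2] := boolP (z2 == v + 1).
  apply: (@in_list_two D u v z1) => [|x y]; first by move: z2v zz; clear; lia.
  by rewrite DE; apply/idP/idP; move: w2u z2v zz; clear; lia.
exfalso; have [z1v|h3] := boolP (z1 == v + 3).
  apply: (@four_three D u v) dD => -[x y]; rewrite DE !inE !xpair_eqE.
  by apply/idP/idP; move: w2u vz zz h1 h2 z1v; clear; lia.
apply: (@long_overlap D u (v + 2)) dD => -[x y].
by rewrite !inE !xpair_eqE DE; move: w2u vz zz h1 h2 h3; clear; lia.
Qed.

(** One minimal and two maximal cells. Unless one arm has thickness one, up to transposition the
    previous case, the block at the right end of the top two rows has the bottom left cell strictly
    to its south-west. *)
Lemma ddf_fat_hook (D : diagram) (u v w1 z1 w2 z2 : int) : convex D ->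
  u <= w1 -> w1 < w2 -> v <= z2 -> z2 < z1 ->
  (forall x y, ((x, y) \in D) = [&& u <= x, v <= y &
                                (x <= w1) && (y <= z1) || (x <= w2) && (y <= z2)]) ->
  ddf D -> listed #|` D| D.
Proof.
move=> cD uw ww vz zz DE dD.
have [w1u|h1] := boolP (w1 == u).
  left; left; apply: (@ddf_row_hook D u v z1 w2 z2) => // [|x y].
    by move: w1u ww; clear; lia.
  by rewrite DE (eqP w1u).
have [z1v|h2] := boolP (z1 == v + 1).
  left; right; rewrite -card_transpose.
  apply: (@ddf_row_hook _ v u w2 z1 w1) => // [|x y|].
  - by move: z1v; clear; lia.
  - by rewrite mem_transpose DE /=; apply/idP/idP; move: z1v vz zz; clear; lia.
  - exact: ddf_transpose.
exfalso; apply: (@block_southwest D u (z1 - 1) w2 v) dD.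
- by move: uw ww h1; clear; lia.
- by move: vz zz h2; clear; lia.
- by move=> [x y]; rewrite !inE !xpair_eqE DE; move: uw ww vz zz h1 h2; clear; lia.
Qed.

(** A 2x2 block in one piece is excluded by any cell of the other, so each piece is a row or a
    column. A row and a column give case (v), after rotation if the row is the upper piece; two rows
    or two columns fall under [two_rows]. *)
Lemma ddf_disconnected (D : diagram) (u1 v1 w1 z1 u2 v2 w2 z2 : int) : convex D ->
  u1 <= w1 -> v1 <= z1 -> u2 <= w2 -> v2 <= z2 -> w1 < u2 -> z2 < v1 ->
  (forall x y, ((x, y) \in D) = (u1 <= x <= w1) && (v1 <= y <= z1)
                             || (u2 <= x <= w2) && (v2 <= y <= z2)) ->
  ddf D -> listed #|` D| D.
Proof.
move=> cD uw1 vz1 uw2 vz2 wu zv DE dD.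
have [h1|h1] := boolP ((u1 < w1) && (v1 < z1)).
  exfalso; apply: (@block_southwest D u1 v1 u2 v2) dD.
  - by move: h1 wu; clear; lia.
  - by move: zv vz2; clear; lia.
  - by move=> [x y]; rewrite !inE !xpair_eqE DE; move: h1 uw2 vz2; clear; lia.
have [h2|h2] := boolP ((u2 < w2) && (v2 < z2)).
  exfalso; apply: (@block_northeast D u2 v2 u1 v1) dD.
  - by move: uw1 wu; clear; lia.
  - by move: zv h2; clear; lia.
  - by move=> [x y]; rewrite !inE !xpair_eqE DE; move: h2 uw1 vz1; clear; lia.
have [h3|h3] := boolP ((v1 == z1) && (u2 == w2)).
  left; left; apply: (@in_list_dsum D u1 v1 w1 u2 v2 z2) => // x y; rewrite DE.
  by apply/idP/idP; move: h3; clear; lia.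
have [h4|h4] := boolP ((u1 == w1) && (v2 == z2)).
  right; left; rewrite -card_rotate.
  apply: (@in_list_dsum _ (- w2) (- v2) (- u2) (- u1) (- z1) (- v1)); rewrite ?lerN2 ?ltrN2 //.
  - by move: wu uw1 h4; clear; lia.
  - by move: zv h4; clear; lia.
  - move=> x y; rewrite mem_rotate DE /=.
    by apply/idP/idP; move: h4; clear; lia.
exfalso; have [h5|h5] := boolP (u1 == w1).
  apply: (@two_rows D u1 v1 z1 u2 v2 z2) dD => //.
  - by move: wu uw1; clear; lia.
  - by move: h3 h4 h5 h2 vz1 uw2 vz2; clear; lia.
  - by move: h3 h4 h5 h2 vz1 vz2; clear; lia.
  - move=> [x y]; rewrite DE /in_mem /=.
    by apply/idP/idP; move: h5 h4 h2 uw2 vz2; clear; lia.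
apply: (@two_rows (transpose D) v2 u2 w2 v1 u1 w1) (ddf_transpose cD dD) => //.
- by move: zv vz2; clear; lia.
- by move: h1 h3 h5 uw1 vz1 uw2; clear; lia.
- by move: h5 uw1; clear; lia.
- move=> [x y]; rewrite mem_transpose DE /in_mem /=.
  by apply/idP/idP; move: h1 h2 h3 h5 uw1 vz1 uw2 vz2; clear; lia.
Qed.

(** Two minimal and two maximal cells, with a column common to both parts. If the lower part has two
    rows, a block straddling columns [v1 - 1] and [v1] has the cell [(u1, z1)] to its north-east;
    the upper part is symmetric. If both are single rows, the diagram is a Z-shape. *)
Lemma not_ddf_connected (D : diagram) (u1 v1 w1 z1 u2 v2 w2 z2 : int) :
  u1 < u2 -> v2 < v1 -> w1 < w2 -> z2 < z1 -> u1 <= w1 -> u2 <= w2 -> v1 <= z2 ->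
  (forall x y, ((x, y) \in D) = ((u1 <= x) && (v1 <= y) || (u2 <= x) && (v2 <= y)) &&
                               ((x <= w1) && (y <= z1) || (x <= w2) && (y <= z2))) ->
  ~ ddf D.
Proof.
move=> uu vv ww zz uw1 uw2 vz DE.
have [h1|h1] := boolP (u2 < w2).
  apply: (@block_northeast D (w2 - 1) (v1 - 1) u1 z1).
  - by move: uu h1; clear; lia.
  - by move: vz zz; clear; lia.
  - by move=> [x y]; rewrite !inE !xpair_eqE DE; move: uu vv ww zz uw1 vz h1; clear; lia.
have [h2|h2] := boolP (u1 < w1).
  apply: (@block_southwest D u1 z2 w2 v2).
  - by move: ww h2; clear; lia.
  - by move: vv vz; clear; lia.
  - by move=> [x y]; rewrite !inE !xpair_eqE DE; move: uu vv ww zz uw2 vz h2; clear; lia.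
apply: (@z_shape D u1 v1 z1 u2 v2 z2) => // -[x y].
by rewrite DE /in_mem /= /hull /cle /=; apply/idP/idP; move: uw1 uw2 h1 h2; clear; lia.
Qed.

Lemma ddf_listed (D : diagram) (x0 : cell) : convex D -> x0 \in D -> ddf D -> listed #|` D| D.
Proof.
move=> cD x0D dD.
have [[u1 v1] [[u2 v2] [[w1 z1] [[w2 z2] [DE mM hm hM]]]]] := ddf_hull cD x0D dD.
have {}DE x y : ((x, y) \in D) = ((u1 <= x) && (v1 <= y) || (u2 <= x) && (v2 <= y)) &&
                               ((x <= w1) && (y <= z1) || (x <= w2) && (y <= z2)).
  by rewrite DE.
case: mM; rewrite !DE /= in hm hM * => m1D m2D M1D M2D.
case: hm => [[e1 e2]|[uu vv]]; case: hM => [[e3 e4]|[ww zz]].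
- apply: (@ddf_rectangle D u1 v1 w1 z1) => // [||x y].
  + by move: m1D; rewrite -e1 -e2 -e3 -e4; clear; lia.
  + by move: m1D; rewrite -e1 -e2 -e3 -e4; clear; lia.
  + by rewrite DE -e1 -e2 -e3 -e4; apply/idP/idP; clear; lia.
- apply: (@ddf_fat_hook D u1 v1 w1 z1 w2 z2) => // [||x y].
  + by move: M1D; rewrite -e1 -e2; clear; lia.
  + by move: M2D; rewrite -e1 -e2; clear; lia.
  + by rewrite DE -e1 -e2; apply/idP/idP; clear; lia.
- apply: listed_rotate; rewrite -card_rotate.
  apply: (@ddf_fat_hook _ (- w1) (- z1) (- u2) (- v2) (- u1) (- v1)).
  + exact: convex_rotate.
  + by move: m2D; rewrite -e3 -e4; clear; lia.
  + by rewrite ltrN2.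
  + by move: m1D; rewrite -e3 -e4; clear; lia.
  + by rewrite ltrN2.
  + by move=> x y; rewrite mem_rotate DE -e3 -e4 /=; apply/idP/idP; clear; lia.
  + exact: ddf_rotate.
- have [uw1 vz1 uw2 vz2] : [/\ u1 <= w1, v1 <= z1, u2 <= w2 & v2 <= z2].
    by move: m1D m2D M1D M2D uu vv ww zz; clear => *; split; lia.
  (* [v1 <= z2] means a common column. A common row, [u2 <= w1], is the transposed situation; with
     neither, the two parts are separate rectangles. *)
  case: (lerP v1 z2) => [vz|zv].
    by case: (not_ddf_connected uu vv ww zz uw1 uw2 vz DE).
  case: (lerP u2 w1) => [uw|wu].
    exfalso; apply: (not_ddf_connected vv uu zz ww vz2 vz1 uw) (ddf_transpose cD dD).
    by move=> x y; rewrite mem_transpose DE /=; apply/idP/idP; clear; lia.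
  apply: (@ddf_disconnected D u1 v1 w1 z1 u2 v2 w2 z2) => // x y; rewrite DE.
  by apply/idP/idP; move: uu vv ww zz wu zv; clear; lia.
Qed.
End Classification.

(** * The listed shapes *)

Lemma linext_perm D s t : linext D s -> linext D t -> perm_eq s t.
Proof.
move=> [os sE] [ot tE]; apply: uniq_perm; rewrite ?ordered_uniq // => x.
by rewrite sE tE.
Qed.

(** When each fibre of [f] is a chain, the next cell with a given label must be the least one left
    in its chain, so the labels determine the list. *)
Lemma ordered_chains (f : cell -> bool) s t : ordered s -> ordered t -> perm_eq s t ->
  {in s &, forall x y, f x = f y -> cle x y || cle y x} ->
  map f s = map f t -> s = t.
Proof.
elim: s t => [|x s IHs] [|y t] //= /andP[/allP xs os] /andP[/allP yt ot] st ch [fxy fst].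
have exy : x = y.
  apply/eqP/negPn/negP => ne.
  have xt : x \in t by have := mem_head x s; rewrite (perm_mem st) inE (negPf ne).
  have ys : y \in s by have := mem_head y t; rewrite -(perm_mem st) inE eq_sym (negPf ne).
  have := ch x y (mem_head _ _); rewrite inE ys orbT => /(_ isT fxy).
  by rewrite (negPf (xs _ ys)) (negPf (yt _ xt)).
rewrite -exy in st *; congr cons; apply: IHs => //; first by rewrite perm_cons in st.
by move=> a b as_ bs; apply: ch; rewrite inE (as_, bs) orbT.
Qed.

Definition step_word (g : rel bool) (w : seq bool) : seq bool :=
  if w is b :: w' then pairmap g b w' else [::].

Lemma dword_step (f : cell -> bool) (g : rel bool) s : ordered s ->
  {in s &, forall c d, ~~ cle d c -> dbit c d = g (f c) (f d)} ->
  dword s = step_word g (map f s).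
Proof.
case: s => //= x s; elim: s x => //= y s IHs x /andP[/andP[nyx _] os] h.
rewrite IHs //; last by move=> a b as_ bs; apply: h; rewrite inE (as_, bs) orbT.
by rewrite h ?inE ?eqxx ?orbT.
Qed.

(** For a diagram cut into two chains by [f], with descents read off by [g] from consecutive labels,
    it remains to recover a binary word from its image under [step_word g]. *)
Lemma ddf_step (f : cell -> bool) (g : rel bool) (D : diagram) :
  {in D &, forall x y, f x = f y -> cle x y || cle y x} ->
  {in D &, forall c d, ~~ cle d c -> dbit c d = g (f c) (f d)} ->
  (forall s t, linext D s -> linext D t ->
     step_word g (map f s) = step_word g (map f t) -> map f s = map f t) ->
  ddf D.
Proof.
move=> ch hg inj s t ls lt; have st := linext_perm ls lt.
case: (ls) (lt) => [os sE] [ot tE].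
rewrite (@dword_step f g s) //; last by move=> c d; rewrite !sE; exact: hg.
rewrite (@dword_step f g t) //; last by move=> c d; rewrite !tE; exact: hg.
move/(inj _ _ ls lt); apply: ordered_chains => //.
by move=> x y; rewrite !sE; exact: ch.
Qed.

Lemma linext_head D s m : linext D s -> m \in D -> {in D, forall x, cle m x} ->
  exists s', s = m :: s'.
Proof.
move=> [os sE] mD mmin; have := mD; rewrite -sE.
case: s os sE => // x s /= /andP[/allP xs _] sE; rewrite inE => /predU1P[->|/xs].
  by exists s.
by rewrite mmin // -sE mem_head.
Qed.

(** A step is a descent exactly when it enters a cell below the first row. The descent word is thus
    the label word without its first letter, which always belongs to the corner. *)
Lemma ddf_hook a k : ddf (young (a.+1 :: nseq k 1)).
Proof.
set D := young _.
have DP x y : (x, y) \in D -> [&& (0 <= x)%R, (0 <= y)%R & (x == 0%R) || (y == 0%R)].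
  rewrite mem_young; case E: `|x|%N => [|i] /=; first by move: E; clear; lia.
  by rewrite nth_nseq; case: (ltnP i k) => _; move: E; clear; lia.
have D0 : (0, 0)%R \in D by rewrite mem_young.
have Dmin : {in D, forall x, cle (0, 0)%R x}.
  by move=> [x y] /DP; rewrite /cle /=; clear; lia.
apply: (@ddf_step (fun c => 0 < c.1)%R (fun _ b => b)).
- by move=> [a1 a2] [b1 b2] /DP h1 /DP h2; rewrite /cle /=; move: h1 h2; clear; lia.
- move=> [a1 a2] [b1 b2] /DP h1 /DP h2; rewrite /cle /dbit /= => h3.
  by apply/idP/idP; move: h1 h2 h3; clear; lia.
move=> s t /linext_head /(_ D0 Dmin)[s' ->] /linext_head /(_ D0 Dmin)[t' ->] /=.
have e w b : pairmap (fun _ b : bool => b) b w = w by elim: w b => //= c w IHw b; rewrite IHw.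
by rewrite !e => ->.
Qed.

(** A step is a descent exactly when it leaves a cell of the column, since the whole row lies below
    the column. The descent word is the label word without its last letter. *)
Lemma ddf_dsum (D : diagram) a k :
  is_dsum (young [:: a]) (young (nseq k 1)) D -> ddf D.
Proof.
move=> [[u2 v2] [[u1 v1] [eD sep]]].
set D1 := translate (u2, v2) _ in eD sep; set D2 := translate (u1, v1) _ in eD sep.
have D1P c : c \in D1 -> c.1 = u2.
  case: c => x y; rewrite mem_translate mem_young /=.
  case E: `|x - u2|%N => [|i] /=; rewrite ?nth_nil; move: E; clear; lia.
have D2P c : c \in D2 -> c.2 = v1.
  case: c => x y; rewrite mem_translate mem_young /= nth_nseq.
  by case: (ltnP _ k) => _; clear; lia.
have {eD} DP c : c \in D -> if c \in D2 then c \in D2 else c \in D1.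
  by rewrite eD inE orbC; case: ifP.
apply: (@ddf_step (fun c => c \in D2) (fun b _ => b)).
- move=> c d /DP + /DP; case: ifP; case: ifP => // _ _ hc hd _; rewrite /cle.
    by rewrite (D2P c) // (D2P d) // lexx !andbT le_total.
  by rewrite (D1P c) // (D1P d) // lexx /= le_total.
- move=> c d /DP + /DP; rewrite /cle /dbit; case: ifP; case: ifP => _ _ hc hd.
  + by rewrite (D2P c) // (D2P d) // lexx andbT -ltNge.
  + by have [] := sep d c hd hc.
  + by have [h _] := sep c d hc hd; move=> _; apply/negbTE; rewrite -leNgt ltW.
  + by rewrite (D1P c) // (D1P d) // ltxx.
have e w b : pairmap (fun b _ : bool => b) b w = belast b w.
  by elim: w b => //= c w IHw b; rewrite IHw.
move=> s t ls lt; have st := linext_perm ls lt.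
(* The number of column cells is fixed by the shape and yields the missing last label. *)
have := perm_map (fun c => c \in D2) st => /permP/(_ id).
case: s t st {ls lt} => [|x s] [|y t] st; do ?[by move: (perm_size st)].
rewrite !map_cons /step_word !e !lastI => + ew.
rewrite ew -!cats1 !count_cat /= => /addnI h.
by congr (_ ++ [:: _]); move: h; do 2 case: last.
Qed.

Definition rise (b c : bool) : bool := ~~ b && c.

(** Where the words first differ, neither has a rise, so the preceding letter is [true]. By the
    bound two, the word continuing with [true] has no further [true] and hence no further rise,
    whereas the other still has a [true] after its [false]. *)
Lemma rise_inj (b : bool) (w w' : seq bool) : count id w = count id w' -> count id w + b <= 2 ->
  pairmap rise b w = pairmap rise b w' -> w = w'.
Proof.
have some (v : seq bool) : 0 < count id v -> has id (pairmap rise false v).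
  by elim: v => //= -[].
have none c (v : seq bool) : count id v = 0 -> has id (pairmap rise c v) = false.
  by elim: v c => //= -[] v IHv c //= /IHv ->; rewrite /rise andbF.
have mixed (v v' : seq bool) : count id v = 0 -> 0 < count id v' ->
    pairmap rise true v = pairmap rise false v' -> False.
  by move=> c0 /some + e; rewrite -e none.
elim: w w' b => [|x w IHw] [|y w'] b //= cw le2 [] exy e.
case: x y cw le2 exy e => [] [] cw le2 exy e.
- by congr cons; apply: (IHw _ true) => //; move: cw le2; case: (b); lia.
- case: b le2 exy => // le2 _; case: (@mixed w w') => //; move: cw le2; clear; lia.
- case: b le2 exy => // le2 _; case: (@mixed w' w) => //; move: cw le2; clear; lia.
- by congr cons; apply: (IHw _ false) => //; move: cw le2; case: (b); lia.
Qed.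

(** Descents are the passages from the first row to the second, that is, the rises of the label
    word; the second row has only two cells, so [rise_inj] applies after the corner. *)
Lemma ddf_two a : ddf (young [:: a.+2; 2]).
Proof.
set D := young _.
have DP x y : (x, y) \in D -> [&& (0 <= x)%R, (0 <= y)%R &
    (x == 0%R) || ((x == 1%R) && (y <= 1)%R)].
  by rewrite mem_young; case E: `|x|%N => [|[|i]] /=; rewrite ?nth_nil; move: E; clear; lia.
have D0 : (0, 0)%R \in D by rewrite mem_young.
have Dmin : {in D, forall x, cle (0, 0)%R x}.
  by move=> [x y] /DP; rewrite /cle /=; clear; lia.
apply: (@ddf_step (fun c => 0 < c.1)%R rise).
- by move=> [a1 a2] [b1 b2] /DP h1 /DP h2; rewrite /cle /=; move: h1 h2; clear; lia.
- move=> [a1 a2] [b1 b2] /DP h1 /DP h2; rewrite /cle /dbit /rise /= => h3.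
  by apply/idP/idP; move: h1 h2 h3; clear; lia.
move=> s t ls lt; have := perm_map (fun c : cell => 0 < c.1)%R (linext_perm ls lt).
move/permP/(_ id).
have : count id (map (fun c : cell => 0 < c.1)%R s) <= 2.
  rewrite count_map -size_filter.
  apply: (@uniq_leq_size _ _ [:: (1, 0); (1, 1)]%R).
    by apply: filter_uniq; case: ls => /ordered_uniq.
  move=> [x y]; rewrite mem_filter (proj2 ls) => /andP[/= h /DP].
  by rewrite !inE !xpair_eqE; move: h; clear; lia.
have [s' ->] := linext_head ls D0 Dmin; have [t' ->] := linext_head lt D0 Dmin.
by rewrite !map_cons /= => le2 e /rise_inj -> //; rewrite addn0.
Qed.

(** * Exhaustive enumeration for the shapes (3,3) and (4,4) *)

Fixpoint linexts (k : nat) (A : seq cell) : seq (seq cell) :=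
  if k is k'.+1 then
    flatten [seq [seq x :: s | s <- linexts k' (rem x A)]
            | x <- A & all (fun y => cle y x ==> (y == x)) A]
  else [:: [::]].

Lemma mem_linexts s A : ordered s -> perm_eq s A -> s \in linexts (size s) A.
Proof.
elim: s A => [|x s IHs] A //= /andP[/allP xs os] sA.
have xA : x \in A by rewrite -(perm_mem sA) mem_head.
apply/flatten_mapP; exists x.
  rewrite mem_filter xA andbT; apply/allP => y; rewrite -(perm_mem sA) inE.
  by case/predU1P=> [->|/xs/negbTE -> //]; rewrite eqxx implybT.
apply: map_f; apply: IHs => //.
by rewrite -(perm_cons x) (perm_trans sA) // perm_to_rem.
Qed.

(** Turns the property into a boolean computation; it is run on the 5 tableaux of shape (3,3) and
    the 14 of shape (4,4). *)
Lemma ddf_compute (D : diagram) (A : seq cell) : uniq A -> D =i A ->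
  (let l := linexts (size A) A in
   all (fun s => all (fun t => (dword s == dword t) ==> (s == t)) l) l) -> ddf D.
Proof.
move=> uA DA /allP h s t [os sE] [ot tE] e.
have pA u : ordered u -> u =i D -> u \in linexts (size A) A.
  move=> ou uE; have p : perm_eq u A.
    by apply: uniq_perm => // [|x]; rewrite ?ordered_uniq // uE DA.
  by rewrite -(perm_size p); exact: mem_linexts.
have /allP/(_ _ (pA t ot tE)) := h _ (pA s os sE).
by rewrite e eqxx => /eqP.
Qed.

Lemma ddf_three_three : ddf (young [:: 3; 3]).
Proof.
apply: (@ddf_compute _ [seq (i%:Z, j%:Z)%R | i <- iota 0 2, j <- iota 0 3]) => //.
by move=> c; rewrite in_fset.
Qed.

Lemma ddf_four_four : ddf (young [:: 4; 4]).
Proof.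
apply: (@ddf_compute _ [seq (i%:Z, j%:Z)%R | i <- iota 0 2, j <- iota 0 4]) => //.
by move=> c; rewrite in_fset.
Qed.

Lemma in_list_ddf n D : in_list n D -> ddf D.
Proof.
have shape la : ddf (young la) -> same_shape D (young la) -> ddf D.
  by move=> dla [v ->]; exact: ddf_translate.
case=> [[_]|]; first by apply: shape; exact: ddf_three_three.
case=> [[_]|]; first by apply: shape; exact: ddf_four_four.
case=> [[n4]|]; first apply: shape.
  by rewrite (_ : n - 2 = (n - 4).+2); [exact: ddf_two | lia].
case=> [[n1 [k [kn]]]|[k [_ /ddf_dsum //]]]; apply: shape.
by rewrite (_ : n - k = (n - k).-1.+1); [exact: ddf_hook | lia].
Qed.

Lemma listed_ddf n D : convex D -> listed n D -> ddf D.
Proof.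
have tr E : convex E -> in_list_up_to_transpose n E -> ddf E.
  move=> cE [/in_list_ddf //|/in_list_ddf h].
  by rewrite -(transposeK E); apply: ddf_transpose => //; exact: convex_transpose.
move=> cD [/tr|/tr h]; first exact.
by rewrite -(rotateK D); apply: ddf_rotate; apply: h; exact: convex_rotate.
Qed.

(** * Tableaux as linear extensions *)

Lemma part_nth la i j : is_part la -> i <= j -> nth 0 la j <= nth 0 la i.
Proof.
move=> /andP[so _] ij; case: (ltnP j (size la)) => lt_j; last by rewrite (nth_default _ lt_j).
have tr : transitive geq by move=> a b c /= h1 h2; exact: leq_trans h2 h1.
apply: (sorted_leq_nth tr leqnn 0 so) => //; rewrite inE //; exact: leq_ltn_trans lt_j.
Qed.

Lemma young_down la (i j k l : int) : is_part la -> (i, j) \in young la ->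
  (0 <= k <= i)%R -> (0 <= l <= j)%R -> (k, l) \in young la.
Proof.
move=> pla; rewrite !mem_young => /and3P[_ _ lt] ki lj.
have := @part_nth la `|k| `|i| pla; move: lt ki lj; clear => lt ki lj h.
by have {}h := h (ltac:(lia)); lia.
Qed.

(** Young diagrams are down-closed in the quadrant, and a difference of two down-closed sets is
    convex. *)
Lemma skew_convex D : is_skew_diagram D -> convex D.
Proof.
move=> [la [mu [pla pmu _ ->]]] [x1 x2] [y1 y2] [z1 z2]; rewrite /Defs.skew !in_fsetD /cle /=.
move=> /andP[nx xla] /andP[_ yla] xz zy.
have x0 : (0 <= x1)%R && (0 <= x2)%R by move: xla; rewrite mem_young => /and3P[-> ->].
apply/andP; split.
  by apply: contra nx => /young_down; apply => //; move: x0 xz; clear; lia.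
by apply: young_down yla _ _ => //; move: x0 xz zy; clear; lia.
Qed.

Lemma syt_linext (D : diagram) (T : filling D) : convex D -> is_syt T ->
  exists2 s, linext D s & forall c, T c = index (val c) s :> nat.
Proof.
move=> cD /and3P[/injectiveP injT /forallP rowT /forallP colT].
have [g TK gK] : bijective T by apply: inj_card_bij => //; rewrite card_ord cardfE.
pose s := [seq val (g i) | i <- enum 'I_#|` D|].
have iT c : T c = index (val c) s :> nat.
  rewrite /s (map_comp val g) (index_map val_inj) -{2}(TK c).
  by rewrite (index_map (can_inj gK)) index_enum_ord.
have us : uniq s.
  by rewrite map_inj_uniq ?enum_uniq //; apply: inj_comp val_inj (can_inj gK).
have sE : s =i D.
  move=> x; apply/mapP/idP => [[i _ ->]|xD]; first exact: valP.
  by exists (T [` xD]); rewrite ?mem_enum // TK.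
exists s => //; split=> //; apply: index_ordered => // x y; rewrite !sE => xD yD xy.
(* Tableau conditions compare only cells of one row or one column; this corner, in [D] by convexity,
   links [x] to [y] by a row step and a column step. *)
pose z : cell := (x.1, y.2).
have xz : cle x z by move: xy; rewrite /cle /z /=; clear; lia.
have zy : cle z y by move: xy; rewrite /cle /z /=; clear; lia.
have zD := cD _ _ _ xD yD xz zy.
have h1 : T [` xD] <= T [` zD].
  have /forallP/(_ [` zD])/implyP := rowT [` xD]; rewrite /entry /= eqxx /=.
  case: (ltrP x.2 y.2) => [_ /(_ isT)|le _]; first by rewrite ltnS => /ltnW.
  have e : x.2 = y.2 by apply/le_anti; rewrite le andbT; case/andP: xy.
  by rewrite (_ : [` xD] = [` zD]) //; apply: val_inj; rewrite /= /z -e -surjective_pairing.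
have h2 : T [` zD] <= T [` yD].
  have /forallP/(_ [` yD])/implyP := colT [` zD]; rewrite /entry /= eqxx /=.
  case: (ltrP x.1 y.1) => [_ /(_ isT)|le _]; first by rewrite ltnS => /ltnW.
  have e : x.1 = y.1 by apply/le_anti; rewrite le andbT; case/andP: xy.
  by rewrite (_ : [` zD] = [` yD]) //; apply: val_inj; rewrite /= /z e -surjective_pairing.
by have := leq_trans h1 h2; rewrite !iT.
Qed.

Lemma linext_size D s : linext D s -> size s = #|` D|.
Proof.
case=> os sE; apply: perm_size; apply: uniq_perm => [||x]; last by rewrite sE.
  exact: ordered_uniq.
exact: fset_uniq.
Qed.

Lemma linext_syt (D : diagram) s : linext D s ->
  exists2 T : filling D, is_syt T & forall c, T c = index (val c) s :> nat.
Proof.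
move=> ls; have [os sE] := ls.
have ltP (c : D) : index (val c) s < #|` D|.
  by rewrite -(linext_size ls) index_mem sE; exact: valP.
pose T : filling D := [ffun c : D => Ordinal (ltP c)].
have iT c : T c = index (val c) s :> nat by rewrite ffunE.
have injT : injective T.
  have ms (c : D) : val c \in s by rewrite sE; exact: valP.
  move=> c d e; apply: val_inj.
  by rewrite -(nth_index (0, 0)%R (ms c)) -(nth_index (0, 0)%R (ms d)) -!iT e.
have mono (c d : D) : cle (val c) (val d) -> c != d -> T c < T d.
  move=> cd ne; rewrite ltn_neqAle -(inj_eq injT) in ne *.
  by rewrite ne !iT; apply: ordered_index => //; rewrite sE fsvalP.
exists T => //; apply/and3P; split; first exact/injectiveP.
- apply/forallP => c; apply/forallP => d; apply/implyP => /andP[/eqP e lt].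
  rewrite /entry ltnS; apply: mono; first by rewrite /cle e lexx ltW.
  by apply: contraTneq lt => ->; rewrite ltxx.
- apply/forallP => c; apply/forallP => d; apply/implyP => /andP[/eqP e lt].
  rewrite /entry ltnS; apply: mono; first by rewrite /cle e lexx ltW.
  by apply: contraTneq lt => ->; rewrite ltxx.
Qed.

(** The shift arises because entries start at 1, while the values of [T] and the positions in [s]
    start at 0. *)
Lemma descent_dword (D : diagram) (T : filling D) s i : linext D s ->
  (forall c, T c = index (val c) s :> nat) -> i < #|` D|.-1 ->
  is_descent T i.+1 = nth false (dword s) i.
Proof.
move=> ls iT lt_i; have [os sE] := ls; have ss := linext_size ls.
have us := ordered_uniq os.
have lt1 : i.+1 < size s by rewrite ss; move: lt_i; clear; lia.
pose x0 : cell := (0, 0)%R; rewrite (nth_dword x0) //.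
apply/existsP/idP => [[c /existsP[d /and3P[]]]|h].
  rewrite /entry !eqSS !iT => /eqP ic /eqP id.
  by rewrite /dbit -id -ic !nth_index ?sE ?fsvalP.
have cD : nth x0 s i \in D by rewrite -sE mem_nth // ltnW.
have dD : nth x0 s i.+1 \in D by rewrite -sE mem_nth.
exists [` cD]; apply/existsP; exists [` dD].
by rewrite /entry !eqSS !iT /= !index_uniq ?eqxx //= ltnW.
Qed.

Lemma eq_descents (D : diagram) (T U : filling D) s t : linext D s -> linext D t ->
  (forall c, T c = index (val c) s :> nat) -> (forall c, U c = index (val c) t :> nat) ->
  descents T = descents U <-> dword s = dword t.
Proof.
move=> ls lt iT iU; have [ss st] := (linext_size ls, linext_size lt).
split=> [e|e].
  apply: (@eq_from_nth _ false) => [|i]; rewrite !size_dword ss ?st // => lt_i.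
  have : (i.+1 \in descents T) = (i.+1 \in descents U) by rewrite e.
  rewrite !mem_filter mem_iota add1n !ltnS lt_i !andbT.
  by rewrite (descent_dword ls) // (descent_dword lt).
apply: eq_in_filter => -[|i]; rewrite mem_iota // add1n ltnS => /andP[_ lt_i].
by rewrite (descent_dword ls) // (descent_dword lt) // e.
Qed.

Lemma distinct_ddf D : convex D -> distinct_descent_sets D <-> ddf D.
Proof.
move=> cD; split=> [dD s t ls lt e|dD T U].
  have [[T sT iT] [U sU iU]] := (linext_syt ls, linext_syt lt).
  have TU : T = U by apply: dD => //; apply/(eq_descents ls lt).
  have ss : size s = size t by rewrite (linext_size ls) (linext_size lt).
  apply: (@eq_from_nth _ (0, 0)%R) => // i lt_i.
  have xD : nth (0, 0)%R s i \in D by rewrite -(proj2 ls) mem_nth.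
  have := iT [` xD]; rewrite TU iU /= index_uniq ?ordered_uniq //; last by case: ls.
  by move=> ei; rewrite -{2}ei nth_index // (proj2 lt).
move=> /(syt_linext cD)[s ls iT] /(syt_linext cD)[t lt iU].
move/(eq_descents ls lt iT iU)/(dD _ _ ls lt) => st.
by apply/ffunP => c; apply: val_inj; rewrite /= iT iU st.
Qed.

(** * Linear independence of the fundamental quasisymmetric functions *)

(** Only the sorted arrangement of a monomial is weakly increasing, so each coefficient of [F al] is
    0 or 1. *)
Lemma F_sort al (m : {mset nat}%mset) : F al m = Posz (F_index al (sort leq m)).
Proof.
rewrite /F; congr Posz; set s0 := sort leq m.
have s0m : s0 \in permutations m by rewrite mem_permutations perm_sort.
have e : {in permutations m, F_index al =1 (fun s => F_index al s0 && (s == s0))}.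
  move=> s; rewrite mem_permutations => sm.
  case: (eqVneq s s0) => [->|ne]; first by rewrite andbT.
  rewrite andbF; apply: contra_neqF ne => /and3P[_ so _].
  apply: (sorted_eq leq_trans anti_leq) => //; first exact: (sort_sorted leq_total).
  by rewrite perm_sym perm_sort perm_sym.
rewrite (eq_in_count e); case: (F_index al s0) => /=; last by rewrite count_pred0.
by rewrite (count_uniq_mem _ (permutations_uniq _)) s0m.
Qed.

Lemma foldl_addn x (s : seq nat) : foldl addn x s = x + sumn s.
Proof. by elim: s x => [|y s IHs] x /=; rewrite ?addn0 // IHs addnA. Qed.

(** Once the total is appended to [comp_set], passing between compositions and sets is the inversion
    of partial sums by successive differences. *)
Lemma scanl_comp a al :
  scanl addn 0 (a :: al) = rcons (comp_set (a :: al)) (sumn (a :: al)).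
Proof.
apply: (@eq_from_nth _ 0) => [|i].
  by rewrite size_scanl size_rcons size_map size_iota.
rewrite size_scanl => lt_i; rewrite (nth_scanl 0) // foldl_addn add0n.
rewrite nth_rcons size_map size_iota [(size (a :: al)).-1]/=.
case: ltngtP => [lt|lt|->].
- by rewrite (nth_map 0) ?size_iota // nth_iota.
- by move: lt_i; rewrite ltnS leqNgt lt.
- by rewrite take_oversize.
Qed.

Lemma comp_setK al : 0 < sumn al -> comp_of_set (sumn al) (comp_set al) = al.
Proof.
case: al => // a al; rewrite /comp_of_set; case E: (sumn _) => [//|n] _.
rewrite -E -scanl_comp; apply: scanlK => x y; exact: addKn.
Qed.

Lemma comp_sum0 al : is_comp al -> sumn al = 0 -> al = [::].
Proof. by case: al => // -[|a] al; rewrite /is_comp inE. Qed.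

Lemma comp_path al x : is_comp al -> path ltn x (scanl addn x al).
Proof.
elim: al x => //= a al IHal x; rewrite /is_comp inE negb_or => /andP[a0 /IHal ->].
by rewrite andbT -[X in X < _]addn0 ltn_add2l lt0n eq_sym.
Qed.

Lemma comp_set_path al : is_comp al -> 0 < sumn al ->
  path ltn 0 (rcons (comp_set al) (sumn al)).
Proof. by case: al => // a al ca _; rewrite -scanl_comp; exact: comp_path. Qed.

Lemma comp_set_bounds al j : is_comp al -> j \in comp_set al -> 0 < j < sumn al.
Proof.
move=> ca; case: (posnP (sumn al)) => [/(comp_sum0 ca) -> //|s0 jal].
have := comp_set_path ca s0; rewrite rcons_path => /andP[p l].
have := p; rewrite (path_sortedE ltn_trans) => /andP[/allP/(_ j jal) -> so] /=.
have tr : transitive ltn := ltn_trans.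
have : path ltn 0 (rcons (comp_set al) (sumn al)) by rewrite rcons_path p.
by move/path_sorted; rewrite (sorted_pairwise tr) pairwise_rcons => /andP[/allP/(_ j jal)].
Qed.

Lemma comp_set_sorted al : is_comp al -> sorted ltn (comp_set al).
Proof.
move=> ca; case: (posnP (sumn al)) => [/(comp_sum0 ca) -> //|s0].
by have := comp_set_path ca s0; rewrite rcons_path => /andP[/path_sorted].
Qed.

(* The weakly increasing word whose strict rises occur exactly at comp_set al. *)
Definition comp_word (al : seq nat) : seq nat :=
  [seq count (fun k => k <= j) (comp_set al) | j <- iota 0 (sumn al)].

Lemma comp_word_sorted al : sorted leq (comp_word al).
Proof.
rewrite /comp_word; move: (0) => i; elim: (sumn al) i => //= n IHn i.
rewrite (path_sortedE leq_trans) IHn andbT; apply/allP => x /mapP[j].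
rewrite mem_iota => /andP[ij _] ->; apply: sub_count => k /= ki.
by rewrite (leq_trans ki) // ltnW.
Qed.

(** The letter at position [j] exceeds the previous one by the multiplicity of [j] in [comp_set al],
    so strictness at all of [comp_set be] becomes containment of sets. *)
Lemma F_index_comp_word al be : is_comp al -> is_comp be ->
  F_index be (comp_word al) = (sumn al == sumn be) && all (mem (comp_set al)) (comp_set be).
Proof.
move=> ca cb; rewrite /F_index comp_word_sorted /= size_map size_iota.
case: eqP => //= e; apply: eq_in_all => j /(comp_set_bounds cb); rewrite -e => /andP[j0 lt_j].
have lt_j1 : j.-1 < sumn al by move: j0 lt_j; clear; lia.
rewrite !(nth_map 0) ?size_iota // !nth_iota // !add0n.
have h : count (fun k => k <= j) (comp_set al) =
         count (fun k => k <= j.-1) (comp_set al) + count_mem j (comp_set al).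
  rewrite -[RHS]count_predUI [count (predI _ _) _](_ : _ = 0).
    rewrite addn0; apply: eq_count => k /=; move: j0; clear; lia.
  by apply/eqP; rewrite -leqn0 leqNgt -has_count; apply/hasPn => k _ /=; move: j0; clear; lia.
by rewrite h -[X in X < _]addn0 ltn_add2l -has_count has_pred1.
Qed.

(** A nonzero value makes the set of [be] a subset of that of [al]; as [be] is at least as long, the
    sets coincide. This is the triangularity behind linear independence. *)
Lemma F_comp_word al be : is_comp al -> is_comp be -> size al <= size be ->
  F be (seq_mset (comp_word al)) = (be == al)%:R%R.
Proof.
move=> ca cb le; rewrite F_sort.
have -> : sort leq (seq_mset (comp_word al)) = comp_word al.
  apply: (sorted_eq leq_trans anti_leq); rewrite ?comp_word_sorted //.
    exact: (sort_sorted leq_total).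
  by rewrite perm_sort perm_eq_seq_mset.
rewrite F_index_comp_word //.
case: (eqVneq be al) => [->|ne].
  by rewrite eqxx /=; have -> : all (mem (comp_set al)) (comp_set al) by apply/allP.
case: eqP => //= e; case: allP => // sub; case/eqP: ne.
have us : uniq (comp_set be) := sorted_uniq ltn_trans ltnn (comp_set_sorted cb).
have [] := uniq_min_size us sub; first by rewrite !size_map !size_iota; move: le; clear; lia.
move=> _ eqi.
have es : comp_set be = comp_set al.
  by apply: (irr_sorted_eq ltn_trans ltnn); rewrite ?comp_set_sorted.
case: (posnP (sumn al)) => [s0|s0].
  by rewrite (comp_sum0 ca s0) (comp_sum0 cb) // -e.
by rewrite -(comp_setK s0) -es e comp_setK // -e.
Qed.

Lemma F_independent (X : seq (seq nat)) (d : seq nat -> int) : uniq X -> all is_comp X ->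
  (forall m, (\sum_(al <- X) d al * F al m = 0)%R) -> {in X, forall al, d al = 0%R}.
Proof.
move=> uX /allP cX h al0 al0X; apply/eqP/negPn/negP => nz.
(* Maximising minus the length picks a shortest composition with nonzero coefficient. *)
have := @seq_argmax _ (fun al : seq nat => - (size al)%:Z)%R [seq al <- X | d al != 0%R] al0.
rewrite mem_filter nz al0X => /(_ isT)[al]; rewrite mem_filter => /andP[dal alX] almin.
have := h (seq_mset (comp_word al)); rewrite (bigD1_seq al) //= big1_seq.
  by rewrite addr0 F_comp_word ?cX // eqxx mulr1 => /eqP; rewrite (negPf dal).
move=> be /andP[ne beX]; case: (eqVneq (d be) 0%R) => [->|nzb]; first by rewrite mul0r.
rewrite F_comp_word ?cX ?(negPf ne) ?mulr0 //.
have := almin be; rewrite mem_filter nzb beX => /(_ isT); clear; lia.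
Qed.

Lemma scanl_differences x l : path ltn x l ->
  scanl addn x (pairmap (fun a b => b - a) x l) = l.
Proof.
by elim: l x => //= y l IHl x /andP[xy /IHl e]; rewrite subnKC ?e // ltnW.
Qed.

Lemma differences_comp x l : path ltn x l -> is_comp (pairmap (fun a b => b - a) x l).
Proof.
elim: l x => //= y l IHl x /andP[xy /IHl]; rewrite /is_comp inE negb_or => ->.
by rewrite andbT eq_sym -lt0n subn_gt0.
Qed.

Lemma comp_of_setP n s : 0 < n -> path ltn 0 (rcons s n) ->
  is_comp (comp_of_set n s) /\ comp_set (comp_of_set n s) = s.
Proof.
move=> n0 ps; have -> : comp_of_set n s = pairmap (fun a b => b - a) 0 (rcons s n).
  by case: n n0 ps.
split; first exact: differences_comp.
have := scanl_differences ps; case E: (pairmap _ _ _) => [|a al].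
  by move=> /(congr1 size); rewrite size_rcons.
by rewrite scanl_comp => /rcons_inj[].
Qed.

Lemma comP (D : diagram) (T : filling D) : 0 < #|` D| ->
  is_comp (com T) /\ comp_set (com T) = descents T.
Proof.
move=> n0; apply: comp_of_setP => //.
have e : iota 0 #|` D|.+1 = 0 :: rcons (iota 1 #|` D|.-1) #|` D|.
  case: #|` D| n0 => // k _; rewrite -cats1.
  by have := iotaD 1 k 1; rewrite addn1 add1n /= => ->.
(* Framed by 0 and the size, the descents form a subsequence of an interval, hence increase
   strictly. *)
have : subseq (0 :: rcons (descents T) #|` D|) (iota 0 #|` D|.+1).
  rewrite e -!cats1; apply: (@cat_subseq _ [:: 0] _ [:: 0]) => //.
  by apply: cat_subseq => //; exact: filter_subseq.
by move/(subseq_sorted ltn_trans); apply; exact: iota_ltn_sorted.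
Qed.

Lemma eq_com (D : diagram) (T U : filling D) : 0 < #|` D| ->
  com T = com U -> descents T = descents U.
Proof. by move=> n0 e; rewrite -(proj2 (comP T n0)) -(proj2 (comP U n0)) e. Qed.

Lemma sum_count_mem (T : eqType) (f : T -> int) (s X : seq T) :
  uniq X -> {subset s <= X} ->
  (\sum_(x <- s) f x = \sum_(x <- X) (count_mem x s)%:R * f x)%R.
Proof.
move=> uX; elim: s => [|a s IHs] sX.
  by rewrite big_nil big1 // => x _; rewrite mul0r.
rewrite big_cons IHs; last by move=> x xs; apply: sX; rewrite inE xs orbT.
under [RHS]eq_bigr => x _ do rewrite /= natrD mulrDl.
rewrite big_split /=; congr (_ + _)%R.
rewrite (bigD1_seq a) ?sX ?mem_head //= eqxx mul1r big1 ?addr0 // => x ne.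
by rewrite eq_sym (negPf ne) mul0r.
Qed.

(** By linear independence, the coefficients of any expansion are the multiplicities in the list [S]
    of compositions of tableaux. They are at most 1 exactly when [S] has no repetition; the
    indicator of [S] then gives the expansion. *)
Lemma F_multiplicity_free_distinct (D : diagram) : 0 < #|` D| ->
  F_multiplicity_free (skew_schur D) <-> distinct_descent_sets D.
Proof.
move=> n0; pose S := [seq com T | T <- enum (@is_syt D)].
have cS al : al \in S -> is_comp al by move=> /mapP[T _ ->]; case: (comP T n0).
have SE m : skew_schur D m = (\sum_(al <- S) F al m)%R.
  by rewrite big_map big_enum_cond /skew_schur; apply: eq_bigl => T; rewrite andbT.
split=> [[c [cc ce] c01] T U sT sU e|dD].
  apply/eqP/negPn/negP => neTU.
  (* A common index set for both expansions; coefficients outside the respective support vanish. *)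
  pose X := undup (finsupp c ++ S).
  have uX : uniq X by exact: undup_uniq.
  have comX : all is_comp X.
    by apply/allP => al; rewrite mem_undup mem_cat => /orP[/cc|/cS].
  have d0 m : (\sum_(al <- X) (c al - (count_mem al S)%:R) * F al m = 0)%R.
    under eq_bigr => al _ do rewrite mulrBl.
    rewrite sumrB; apply/eqP; rewrite subr_eq0; apply/eqP.
    rewrite -sum_count_mem // -?SE; last first.
      by move=> al alS; rewrite mem_undup mem_cat alS orbT.
    rewrite ce [LHS](bigID (mem (finsupp c))) /=.
    rewrite [X in (_ + X)%R]big1 ?addr0; last by move=> al /fsfun_dflt ->; rewrite mul0r.
    rewrite -big_filter; apply: perm_big; apply: uniq_perm => [||al].
    - exact: filter_uniq.
    - exact: fset_uniq.
    - by rewrite mem_filter mem_undup mem_cat; case: (al \in finsupp c).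
  have TS : com T \in X.
    by rewrite mem_undup mem_cat orbC map_f // mem_enum.
  have := F_independent uX comX d0 TS.
  have : 2 <= count_mem (com T) S.
    rewrite count_map -size_filter; apply: (@uniq_leq_size _ [:: T; U]).
      by rewrite /= inE neTU.
    move=> V; rewrite !inE mem_filter mem_enum /= => /orP[]/eqP ->.
      by rewrite eqxx.
    by rewrite /com e eqxx.
  by move: (count_mem (com T) S) => k /=; rewrite natz; case: (c01 (com T)) => -> ? ?; lia.
have uS : uniq S.
  rewrite map_inj_in_uniq ?enum_uniq // => T U; rewrite !mem_enum => sT sU.
  by move/(eq_com n0); exact: dD.
pose c : {fsfun seq nat -> int with 0%R} := [fsfun al in seq_fset tt S => 1%R].
have cE al : c al = (if al \in S then 1 else 0)%R by rewrite fsfun_fun seq_fsetE.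
have sc : finsupp c =i S by move=> al; rewrite mem_finsupp cE; case: (al \in S).
exists c; last by move=> al; rewrite cE; case: (al \in S); [right | left].
split=> [al|m]; first by rewrite sc; exact: cS.
rewrite SE (perm_big _ (uniq_perm (fset_uniq _) uS sc)) /=.
by apply: eq_big_seq => al alS; rewrite cE alS mul1r.
Qed.

Theorem theorem3p4 (n : nat) (D : diagram)
    (hD : is_skew_diagram D) (hn : #|` D| = n) (n_gt0 : 0 < n) :
  (F_multiplicity_free (skew_schur D) <->
     in_list_up_to_transpose n D \/ in_list_up_to_transpose n (rotate D)) /\
  (distinct_descent_sets D <->
     in_list_up_to_transpose n D \/ in_list_up_to_transpose n (rotate D)).
Proof.
have cD := skew_convex hD.
have [x0 x0D] : exists x, x \in D.
  have /fset0Pn[x xD] : D != fset0 by rewrite -cardfs_gt0 hn.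
  by exists x.
have dP : distinct_descent_sets D <-> listed n D.
  rewrite (distinct_ddf cD); split; last exact: listed_ddf.
  by rewrite -hn; exact: ddf_listed x0D.
by split=> //; rewrite F_multiplicity_free_distinct ?hn.
Qed.
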